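(* Let $G$ be a finite group of Lie type in characteristic $p$ of Lie rank $2$. Then $G$ has a unique non-trivial minimal synthetic building at $p$ up to $G$-homotopy equivalence, namely its building in the sense of Tits.
   Context: A finite group of Lie type in characteristic $p$ carries its standard split BN-pair of characteristic $p$; Lie rank $2$ means that a Borel subgroup $B$ is contained in exactly two maximal parabolic subgroups $J$ and $K$ (and $B=J\cap K$). The building in the sense of Tits is then the $G$-graph with vertex set $G/J\sqcup G/K$ and edge set $G/B$, the edge $xB$ joining $xJ$ and $xK$. A $G$-simplicial complex is a finite (possibly empty) simplicial complex $\Delta$ with a simplicial action of the finite group $G$ such that the setwise stabilizer of each simplex fixes that simplex pointwise. For $H\le G$, $\Delta^H$ denotes the fixed point subcomplex. Contractible spaces are non-empty. A $G$-simplicial complex $\Delta$ is a synthetic building for $G$ at the prime $p$ if (1) $\Delta^P$ is $N_G(P)$-equivariantly contractible for every non-identity $p$-subgroup $P\le G$, and (2) the stabilizer of every simplex has order divisible by $p$. A synthetic building is non-trivial if it is not $G$-equivariantly homotopy equivalent to a single point. It is minimal if it has no proper $G$-invariant subcomplex that is also a synthetic building for $G$ at $p$. *)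

(* Defs.v *)
From HB Require Import structures.
From mathcomp Require Import all_boot all_order all_algebra all_fingroup all_solvable.

Set Implicit Arguments.
Unset Strict Implicit.
Unset Printing Implicit Defensive.

(** * Split BN-pairs

    Following the usual axiomatic treatment, a finite group of Lie type in
    characteristic [p] is a finite group (the whole of [gT]) with a split
    BN-pair of characteristic [p] whose parabolic subgroups have unipotent
    radicals. *)

(** Elements of the Weyl group [N / (B :&: N)] are cosets; in a double coset
    such as [B w B] they are read as subsets of [gT]. *)
Definition BN_pair (gT : finGroupType) (B N : {group gT}) : Prop :=
  let H := (B :&: N)%g in
  [/\ (B <*> N)%g = [set: gT], (H <| N)%g &
      exists S : {set coset_of H},
        [/\ <<S>>%g = (N / H)%g,
            forall s : coset_of H, s \in S -> #[s]%g = 2,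
            forall s w : coset_of H, s \in S -> w \in (N / H)%g ->
              (set_of_coset s * B * set_of_coset w)%g \subset
                (B * set_of_coset w * B)%g
                  :|: (B * set_of_coset (s * w)%g * B)%g
          & forall s : coset_of H, s \in S ->
              (set_of_coset s * B * set_of_coset s)%g != B ]].

(** For a subgroup [P] containing [B], that is, a standard parabolic subgroup
    [P_I], the intersection of the [U ^ n], [n] in [N :&: P], is
    [U_I = U :&: U ^ w_I] with [w_I] the longest element of the parabolic Weyl
    group [W_I].  The last clause says that [U_I] is normal in [P_I] (the Levi
    decomposition; the BN-pair is "strongly split").  It holds in groups of
    Lie type but does not follow from the other clauses: [(3^2 x 3) : SD16],
    with [p = 2], satisfies those, and has a maximal parabolic subgroup
    [3^2 : SD16] without nontrivial normal 2-subgroup. *)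
Definition split_BN_pair (gT : finGroupType) (p : nat) (B N : {group gT}) :
    Prop :=
  let H := (B :&: N)%g in
  [/\ BN_pair B N, (\bigcap_(n in N) (B :^ n)%g)%SET = H &
      exists U : {group gT},
        [/\ (U ><| H)%g = B, (p.-group U)%g, abelian H, (p^'.-group H)%g
          & forall P : {group gT}, B \subset P ->
              ((\bigcap_(n in (N :&: P)%g) (U :^ n)%g)%SET <| P)%g ]].

Definition lie_rank2 (gT : finGroupType) (B J K : {group gT}) : Prop :=
  [/\ J != K,
      forall M : {group gT},
        (maximal M [set: gT] /\ B \subset M) <-> (M = J \/ M = K)
    & B = (J :&: K)%g :> {set gT}].

From mathcomp Require Import all_classical all_reals all_analysis.

Import Order.TTheory GRing.Theory Num.Theory numFieldNormedType.Exports.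

(** * G-simplicial complexes

    A finite simplicial complex is the set [D] of its nonempty simplices, each
    given as a set of vertices.  The vertices are the [v : V] with
    [[set v] \in D]; [V] may have further elements.  Groups act on the right,
    as always in the library. *)

Definition gcomplex (gT : finGroupType) (V : finType)
    (to : {action gT &-> V}) (D : {set {set V}}) : Prop :=
  [/\ finset.set0 \notin D,
      forall s t : {set V},
        s \in D -> t \subset s -> t != finset.set0 -> t \in D,
      [acts [set: gT], on D | (to^*)%act]
    & forall s : {set V}, s \in D -> ('N(s | to) \subset 'C(s | to))%g].

Definition fixed_complex (gT : finGroupType) (V : finType)
    (to : {action gT &-> V}) (D : {set {set V}}) (A : {set gT}) :
    {set {set V}} :=
  [set s in D | s \subset ('Fix_to(A))%g]%SET.

(** * Geometric realization and equivariant homotopy *)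

(** Barycentric coordinates, with the product topology on [V -> R]. *)
Definition realization (R : realType) (V : finType) (D : {set {set V}}) :
    set {ptws V -> R} :=
  [set x : {ptws V -> R} |
    [/\ forall v, (0 <= x v)%R, (\sum_v x v = 1)%R
      & [set v | x v != 0%R]%SET \in D]]%classic.
Arguments realization R {V} D.

(** The linear extension of the action on vertices: the coordinate of [x a] at
    [v a] is the coordinate of [x] at [v]. *)
Definition ract (R : realType) (gT : finGroupType) (V : finType)
    (to : {action gT &-> V}) (x : {ptws V -> R}) (a : gT) : {ptws V -> R} :=
  fun v => x (to v (a^-1)%g).

(** In what follows a map between realizations is represented by a function on
    the ambient spaces, of which only the restriction matters; [A] is the
    subset of [gT] with respect to which maps are required to be equivariant. *)
Definition gmap (R : realType) (gT : finGroupType) (A : {set gT})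
    (V V' : finType) (to : {action gT &-> V}) (D : {set {set V}})
    (to' : {action gT &-> V'}) (D' : {set {set V'}})
    (f : {ptws V -> R} -> {ptws V' -> R}) : Prop :=
  [/\ {within realization R D, continuous f}%classic,
      forall x, realization R D x -> realization R D' (f x)
    & forall x a, realization R D x -> a \in A ->
        f (ract to x a) = ract to' (f x) a].

Definition ghomotopic (R : realType) (gT : finGroupType) (A : {set gT})
    (V V' : finType) (to : {action gT &-> V}) (D : {set {set V}})
    (to' : {action gT &-> V'}) (D' : {set {set V'}})
    (f g : {ptws V -> R} -> {ptws V' -> R}) : Prop :=
  exists h : R * {ptws V -> R} -> {ptws V' -> R},
    [/\ {within (`[0%R, 1%R] `*` realization R D), continuous h}%classic,
        forall t, (0 <= t <= 1)%R ->
          gmap A to D to' D' (fun x => h (t, x)),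
        forall x, realization R D x -> h (0%R, x) = f x
      & forall x, realization R D x -> h (1%R, x) = g x].

Definition ghomotopy_equiv (R : realType) (gT : finGroupType) (A : {set gT})
    (V V' : finType) (to : {action gT &-> V}) (D : {set {set V}})
    (to' : {action gT &-> V'}) (D' : {set {set V'}}) : Prop :=
  exists (f : {ptws V -> R} -> {ptws V' -> R})
         (g : {ptws V' -> R} -> {ptws V -> R}),
    [/\ gmap A to D to' D' f,
        gmap A to' D' to D g,
        ghomotopic A to D to D (g \o f) id
      & ghomotopic A to' D' to' D' (f \o g) id].

Definition point_act (gT : finGroupType) : {action gT &-> unit} :=
  @TotalAction gT unit (fun x _ => x) (fun _ => erefl) (fun _ _ _ => erefl).

Definition point_complex : {set {set unit}} := [set [set tt]]%SET.

Definition gcontractible (R : realType) (gT : finGroupType) (A : {set gT})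
    (V : finType) (to : {action gT &-> V}) (D : {set {set V}}) : Prop :=
  ghomotopy_equiv R A to D (point_act gT) point_complex.

(** * Synthetic buildings *)

Definition synthetic_building (R : realType) (gT : finGroupType) (p : nat)
    (V : finType) (to : {action gT &-> V}) (D : {set {set V}}) : Prop :=
  [/\ gcomplex to D,
      forall P : {group gT}, (p.-group P)%g -> P :!=: 1%g ->
        gcontractible R ('N(P))%g to (fixed_complex to D P)
    & forall s : {set V}, s \in D -> (p %| #|('N(s | to))%g|)%N].

Definition nontrivial_complex (R : realType) (gT : finGroupType)
    (V : finType) (to : {action gT &-> V}) (D : {set {set V}}) : Prop :=
  ~ ghomotopy_equiv R [set: gT] to D (point_act gT) point_complex.

Definition minimal_synthetic_building (R : realType) (gT : finGroupType)
    (p : nat) (V : finType) (to : {action gT &-> V}) (D : {set {set V}}) :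
    Prop :=
  synthetic_building R p to D /\
  forall D' : {set {set V}}, D' \proper D -> ~ synthetic_building R p to D'.

(** * The Tits building in rank 2

    As groups act on the right, the cosets are right cosets: the edge [B x]
    joins [J x] and [K x]. *)

Definition tits_fun (gT : finGroupType) (v : {set gT} + {set gT}) (a : gT) :
    {set gT} + {set gT} :=
  match v with
  | inl A => inl (A :* a)%g
  | inr A => inr (A :* a)%g
  end.

Lemma tits_fun1 (gT : finGroupType) (v : {set gT} + {set gT}) :
  tits_fun v 1%g = v.
Proof. by case: v => A /=; rewrite mulg1. Qed.

Lemma tits_funM (gT : finGroupType) (v : {set gT} + {set gT}) (a b : gT) :
  tits_fun v (a * b)%g = tits_fun (tits_fun v a) b.
Proof. by case: v => A /=; rewrite rcosetM. Qed.

Definition tits_act (gT : finGroupType) :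
    {action gT &-> ({set gT} + {set gT})%type} :=
  TotalAction (@tits_fun1 gT) (@tits_funM gT).

Definition tits_building (gT : finGroupType) (J K : {group gT}) :
    {set {set ({set gT} + {set gT})%type}} :=
  ([set [set inl (J :* x)%g] | x in [set: gT]]
     :|: [set [set inr (K :* x)%g] | x in [set: gT]]
     :|: [set [set inl (J :* x)%g; inr (K :* x)%g] | x in [set: gT]])%SET.

(* Main.v *)
(** Besides Sylow's theorem and [N_G(U) = B], the argument uses only that the
    subgroups above [B] are [B], [J], [K] and [G], that [J] and [K] have
    nontrivial normal p-subgroups, and two facts on a
    nontrivial p-subgroup [P]: any two chambers fixed by [P] are joined by a
    gallery of fixed chambers, because minimal galleries of given type are
    unique; and [P] fixes no two opposite chambers, because the stabilizer of
    an apartment is a p'-group.  Hence the fixed points of [P] on the Tits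
    building are connected, and among any set of fixed vertices one has at
    most one neighbour in the set (take a chamber at maximal distance from
    another one): they form a tree, which contracts equivariantly by pruning
    leaves.

    Let [D] be a minimal nontrivial synthetic building.  It has no vertex fixed
    by [G], since such a vertex would be a synthetic building.  The fixed
    points of the normal p-subgroups of [J] and [K] being contractible, [D] has
    a vertex fixed by [J] and one fixed by [K]; these are joined by a path of
    vertices fixed by [B], as the fixed points of [U] are [B]-contractible.
    The vertices of a shortest such path have stabilizers [J], [B], ..., [B],
    [K] and lie in distinct orbits, so the translates of the path form a
    subcomplex of [D] which is a subdivision of the Tits building.  This is a
    synthetic building, hence all of [D]. *)
Require Import Defs.
From mathcomp Require Import all_boot all_order all_algebra all_fingroup all_solvable.
From mathcomp Require Import zify.

Set Implicit Arguments.
Unset Strict Implicit.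
Unset Printing Implicit Defensive.

(** * Words in the reflections of a BN-pair *)

Section DoubleCosets.
Local Open Scope group_scope.
Variables (gT : finGroupType) (B : {group gT}).

(** Lie rank 2 is given through maximal subgroups, not through the number of generating reflections,
    so the dictionary between sets of reflections and subgroups above [B] has to come out of the
    exchange axiom: a reflection in the subgroup generated by [B] and a set of reflections already
    belongs to that set. Hence [J] and [K] each contain one reflection up to [H]; these are [s] and
    [t]. Everything is phrased with lifts to [N] and double cosets of [B]. The homotopy side asks
    for explicit continuous equivariant maps. A contraction is exploited in two ways: the support of
    its centre consists of fixed vertices, and the track of a fixed point cannot leave a component
    of the graph of fixed vertices. Conversely, contractions of fixed complexes are constructed for
    the Tits building, and the complex of translates gets them through an equivariant homeomorphism,
    which need not be simplicial because fixed points of a realization depend only on the action.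
    That the Tits building is itself minimal rests on [B] fixing no vertices but the two of its own
    chamber. *)

Definition dcoset (n : gT) : {set gT} := B :* n * B.

Lemma dcosetP g n :
  reflect (exists b b', [/\ b \in B, b' \in B & g = b * n * b']) (g \in dcoset n).
Proof.
apply: (iffP mulsgP) => [[y b' /rcosetP[b Bb ->] Bb' ->]|[b [b' [Bb Bb' ->]]]].
  by exists b, b'.
by exists (b * n) b'; rewrite ?mem_rcoset ?mulgK.
Qed.

Lemma dcoset_refl n : n \in dcoset n.
Proof. by apply/dcosetP; exists 1, 1; rewrite !group1 mulg1 mul1g. Qed.

Lemma mem_dcosetMl b g n : b \in B -> (b * g \in dcoset n) = (g \in dcoset n).
Proof.
move=> Bb; apply/dcosetP/dcosetP => [[c [c' [Bc Bc' e]]]|[c [c' [Bc Bc' ->]]]].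
  by exists (b^-1 * c), c'; split;
    rewrite ?groupM ?groupV // -!mulgA [c * _]mulgA -e mulKg.
by exists (b * c), c'; rewrite groupM // !mulgA.
Qed.

Lemma mem_dcosetMr b g n : b \in B -> (g * b \in dcoset n) = (g \in dcoset n).
Proof.
move=> Bb; apply/dcosetP/dcosetP => [[c [c' [Bc Bc' e]]]|[c [c' [Bc Bc' ->]]]].
  by exists c, (c' * b^-1); split; rewrite ?groupM ?groupV // mulgA -e mulgK.
by exists c, (c' * b); rewrite groupM // !mulgA.
Qed.

Lemma dcoset_sym g n : (g \in dcoset n) = (n \in dcoset g).
Proof.
wlog suff: g n / g \in dcoset n -> n \in dcoset g.
  by move=> h; apply/idP/idP; apply: h.
move=> /dcosetP[b [c [Bb Bc ->]]]; apply/dcosetP; exists b^-1, c^-1.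
by split; rewrite ?groupV // !mulgA mulVg mul1g mulgK.
Qed.

Lemma dcoset_trans g m n : g \in dcoset m -> m \in dcoset n -> g \in dcoset n.
Proof.
by move=> /dcosetP[b [c [Bb Bc ->]]] mn; rewrite mem_dcosetMr ?mem_dcosetMl.
Qed.

Lemma dcosetV g n : (g^-1 \in dcoset n^-1) = (g \in dcoset n).
Proof.
wlog suff: g n / g \in dcoset n -> g^-1 \in dcoset n^-1.
  by move=> h; apply/idP/idP; move/h; rewrite ?invgK.
move=> /dcosetP[b [c [Bb Bc ->]]]; apply/dcosetP; exists c^-1, b^-1.
by split; rewrite ?groupV // !invMg !mulgA.
Qed.

Lemma dcoset1 g : g \in B -> dcoset g = B.
Proof.
move=> Bg; apply/setP=> x; apply/dcosetP/idP => [[b [c [? ? ->]]]|Bx].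
  by rewrite !groupM.
by exists (x * g^-1), 1; rewrite groupM ?groupV // mulg1 mulgKV.
Qed.

End DoubleCosets.

Section BNWords.
Local Open Scope group_scope.
Variables (gT : finGroupType) (B N : {group gT}).
Let H := (B :&: N)%G.
Hypothesis nHN : H <| N.
Local Notation dcoset := (dcoset B).

(* Simple reflections are represented by all their lifts to [N], so [T] is a
   union of cosets of [H]. *)
Definition reflections (T : {set gT}) : Prop :=
  [/\ {in T, forall x, x \in N /\ x \notin B},
      {in H & T, forall h x, h * x \in T},
      {in T, forall x, x * x \in H},
      forall x b n, x \in T -> b \in B -> n \in N ->
        x * b * n \in dcoset n \/ x * b * n \in dcoset (x * n)
    & {in T, forall x, exists2 b, b \in B & x * b * x^-1 \notin B}].

Lemma subset_reflections (T T' : {set gT}) : reflections T -> T' \subset T ->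
  {in H & T', forall h x, h * x \in T'} -> reflections T'.
Proof.
move=> [T1 T2 T3 T4 T5] /subsetP sT' hT';
  split=> // [x /sT'|x /sT'|x b n /sT'|x /sT'].
- exact: T1.
- exact: T3.
- exact: T4.
- exact: T5.
Qed.

Fixpoint words (T : {set gT}) k : {set gT} :=
  if k is k'.+1 then T * words T k' else H.

Lemma HN_swap n h : n \in N -> h \in H -> exists2 h', h' \in H & n * h = h' * n.
Proof.
move=> Nn Hh; exists (n * h * n^-1); last by rewrite mulgKV.
by rewrite -[n in n * h]invgK -mulgA -conjgE memJ_norm // groupV (subsetP
  (normal_norm nHN)).
Qed.

Section Words.
Variable T : {set gT}.
Hypothesis rT : reflections T.

Lemma reflection_N x : x \in T -> x \in N.
Proof. by case: rT => T1 _ _ _ _ /T1[]. Qed.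

Lemma reflectionM h x : h \in H -> x \in T -> h * x \in T.
Proof. by case: rT => _ T2 _ _ _; apply: T2. Qed.

Lemma reflection_sqr x : x \in T -> x * x \in H.
Proof. by case: rT => _ _ T3 _ _; apply: T3. Qed.

Lemma reflection_notB x : x \in T -> x \notin B.
Proof. by case: rT => T1 _ _ _ _ /T1[]. Qed.

Lemma reflectionV x : x \in T -> x^-1 \in T.
Proof.
move=> Tx; have -> : x^-1 = (x * x)^-1 * x by rewrite invMg mulgKV.
by rewrite reflectionM // groupV reflection_sqr.
Qed.

Lemma reflectionMr h x : h \in H -> x \in T -> x * h \in T.
Proof.
move=> Hh Tx; have [h' Hh' ->] := HN_swap (reflection_N Tx) Hh.
exact: reflectionM.
Qed.

Lemma words_sub k n : n \in words T k -> n \in N.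
Proof.
elim: k n => [|k IH] n /=; first by move=> /setIP[].
by move=> /mulsgP[x m /reflection_N Nx /IH Nm ->]; rewrite groupM.
Qed.

Lemma wordsMl k h n : h \in H -> (h * n \in words T k) = (n \in words T k).
Proof.
wlog suff: h n / h \in H -> n \in words T k -> h * n \in words T k.
  move=> IH Hh; apply/idP/idP; last exact: IH.
  by move/(IH h^-1 _); rewrite groupV mulKg; apply.
move=> Hh; case: k => [|k] /=; first by move=> ?; rewrite groupM.
move=> /mulsgP[x m Tx km ->]; apply/mulsgP; exists (h * x) m => //.
  exact: reflectionM.
by rewrite mulgA.
Qed.

Lemma wordsMr k h n : h \in H -> (n * h \in words T k) = (n \in words T k).
Proof.
wlog suff: h n / h \in H -> n \in words T k -> n * h \in words T k.
  move=> IH Hh; apply/idP/idP; last exact: IH.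
  by move/(IH h^-1 _); rewrite groupV mulgK; apply.
move=> Hh kn; have [h' Hh' ->] := HN_swap (words_sub kn) Hh.
by rewrite wordsMl.
Qed.

Lemma words_cons k x n : x \in T -> n \in words T k -> x * n \in words T k.+1.
Proof. by move=> Tx kn; apply/mulsgP; exists x n. Qed.

Lemma words_uncons k x n : x \in T -> x * n \in words T k -> n \in words T k.+1.
Proof.
move=> Tx kn; rewrite -[n](mulKg x); apply: words_cons => //; exact: reflectionV.
Qed.

Lemma wordsD k l m n :
  m \in words T k -> n \in words T l -> m * n \in words T (k + l).
Proof.
elim: k m => [|k IH] m; first by move=> Hm ln; rewrite add0n wordsMl.
move=> /mulsgP[x m' Tx km ->] ln; rewrite addSn -mulgA.
exact/words_cons/IH.
Qed.

Lemma words1 x : x \in T -> x \in words T 1.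
Proof. by move=> Tx; rewrite -[x]mulg1; apply: words_cons; rewrite //= group1. Qed.

Lemma words_rcons k n x : n \in words T k -> x \in T -> n * x \in words T k.+1.
Proof. by move=> kn Tx; rewrite -addn1; apply: wordsD (words1 Tx). Qed.

Lemma words_rconsP k n : n \in words T k.+1 ->
  exists m y, [/\ m \in words T k, y \in T & n = m * y].
Proof.
elim: k n => [|k IH] n.
  move=> /mulsgP[x h Tx Hh ->]; exists 1, (x * h).
  by rewrite mul1g group1 reflectionMr.
move=> /mulsgP[x m Tx /IH[m' [y [km Ty ->]]] ->].
by exists (x * m'), y; rewrite words_cons ?mulgA.
Qed.

(** Uniqueness in the Bruhat decomposition, by induction on the word for [n]. If [n] begins with
    [x], exchange for [x^-1] places the rest of the word in the cell of [n'] or of [x^-1 * n']; the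
    first would give [n'] a word that is too short. *)
Lemma words_dcoset k n n' : n \in words T k -> n' \in N ->
  (forall j, j < k -> n' \notin words T j) -> n' \in dcoset n ->
  exists2 h, h \in H & n' = h * n.
Proof.
case: rT => T1 T2 T3 T4 T5.
elim: k n n' => [|k IH] n n' kn Nn' short n'n.
  have [Bn Nn] := setIP kn; have Bn' : n' \in B by rewrite -(dcoset1 Bn).
  by exists (n' * n^-1); rewrite ?mulgKV // groupM ?groupV // inE Bn' Nn'.
have /mulsgP[x m Tx km nxm] := kn; have Nx := reflection_N Tx.
have Nm := words_sub km; have Vx := reflectionV Tx.
have /dcosetP[b [c [Bb Bc n'E]]] := n'n.
have mE : x^-1 * b^-1 * n' = m * c by rewrite n'E nxm !mulgA mulgKV mulVg mul1g.
have [] := T4 x^-1 b^-1 n' Vx (groupVr Bb) Nn'; rewrite mE mem_dcosetMr // dcoset_sym.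
- move=> /IH[] //; first by move=> j jk; apply: short; apply: ltnW.
  move=> h Hh n'm; by have /negP[] := short k (ltnSn k); rewrite n'm wordsMl.
- move=> /IH[] //; first by rewrite groupM ?groupV.
    by move=> j jk; apply/negP => /(words_uncons Vx); apply/negP/short.
  move=> h Hh xn'; have [h' Hh' e] := HN_swap Nx Hh.
  by exists h' => //; rewrite nxm mulgA -e -mulgA -xn' mulKVg.
Qed.

Definition bruhat_disjoint := forall n n', n \in N -> n' \in N ->
  n' \in dcoset n -> exists2 h, h \in H & n' = h * n.

Lemma words_bruhat_disjoint :
  (forall n, n \in N -> exists k, n \in words T k) -> bruhat_disjoint.
Proof.
move=> genN n n' Nn Nn' n'n.
case: (ex_minnP (genN n Nn)) => k kn kmin.
case: (ex_minnP (genN n' Nn')) => k' kn' kmin'.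
have [le_k|/ltnW le_k] := leqP k k'.
  apply: words_dcoset kn Nn' _ n'n => j jk; apply/negP => /kmin'.
  by rewrite leqNgt (leq_trans jk le_k).
have short j : j < k' -> n \notin words T j.
  move=> jk; apply/negP => /kmin.
  by rewrite leqNgt (leq_trans jk le_k).
rewrite dcoset_sym in n'n; have [h Hh e] := words_dcoset kn' Nn short n'n.
by exists h^-1; rewrite ?groupV // e mulKg.
Qed.

Hypothesis disj : bruhat_disjoint.

Lemma reflection_dcosetN x n : x \in T -> n \in N -> x * n \notin dcoset n.
Proof.
move=> Tx Nn; apply/negP => /(disj Nn (groupM (reflection_N Tx) Nn)).
by move=> [h /setIP[Bh _] /mulIg xh]; move: (reflection_notB Tx); rewrite xh Bh.
Qed.

(** Induction on the last letter [y] of [n = m * y]. If [x * b * n] stayed in the cell of [n],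
    exchange on the right would put [x * b * m], which is in the cell of [x * m], into that of [n]
    or of [m]. Disjointness of cells then shortens [x * n] or makes [x] an element of [B]. *)
Lemma words_ascent k n x b : n \in words T k -> x \in T ->
  (forall j, j < k -> x * n \notin words T j) -> b \in B ->
  x * b * n \in dcoset (x * n).
Proof.
case: rT => T1 T2 T3 T4 T5.
move=> + Tx; have Nx := reflection_N Tx.
elim: k n => [|k IH] n kn short Bb.
  have [Bn _] := setIP kn; apply/dcosetP; exists 1, (n^-1 * b * n).
  by rewrite group1 !groupM ?groupV // !mulgA mul1g mulgK.
have [m [y [km Ty nE]]] := words_rconsP kn.
have Nn := words_sub kn; have Nm := words_sub km; have Ny := reflection_N Ty.
case: (T4 x b n Tx Bb Nn) => // xbn.
have /dcosetP[b1 [b2 [Bb1 Bb2 e]]] := xbn.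
have xbm : x * b * m = b1 * n * b2 * y^-1 by rewrite -e nE mulgA mulgK.
have xbm2 : x * b * m \in dcoset (x * m).
  apply: IH => // j jk; apply/negP => jxm.
  have /negP[] := short j.+1 jk.
  by rewrite nE mulgA words_rcons.
have : (x * b * m)^-1 \in dcoset n^-1 \/ (x * b * m)^-1 \in dcoset m^-1.
  have -> : (x * b * m)^-1 = y * b2^-1 * n^-1 * b1^-1.
    by rewrite xbm !invMg invgK !mulgA.
  have -> : m^-1 = y * n^-1 by rewrite nE invMg mulKVg.
  by rewrite !(@mem_dcosetMr _ B b1^-1) ?groupV //; apply: T4; rewrite ?groupV.
rewrite !dcosetV => -[] h.
  have [|h' Hh' xmE] := disj Nn (groupM Nx Nm).
    by rewrite (dcoset_trans _ h) // dcoset_sym.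
  have /negP[] := short k (ltnSn k).
  rewrite nE mulgA xmE nE -!mulgA wordsMl // wordsMr //.
  by rewrite reflection_sqr.
have /negP[] := reflection_dcosetN Tx Nm.
by rewrite (dcoset_trans _ h) // dcoset_sym.
Qed.

(** Some [b] satisfies [x * b * x^-1 \notin B], so [x * b * x] is in [B x B], and the ascent carries
    this over to [n]. A descent is thus recognized by the fact that multiplication by [x] can stay
    within a cell. *)
Lemma ascent_descent n x : n \in N -> x \in T ->
  (forall b, b \in B -> x * b * n \in dcoset (x * n)) ->
  exists2 b, b \in B & x * b * (x * n) \in dcoset (x * n).
Proof.
case: rT => T1 T2 T3 T4 T5 Nn Tx asc.
have [b Bb xbx] := T5 x Tx; have Nx := reflection_N Tx.
have Vx := reflectionV Tx; exists b => //.
have sx : x * b * x \in dcoset x.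
  have [//|] := T4 x b x Tx Bb Nx.
  have /setIP[Bxx _] := reflection_sqr Tx.
  rewrite (dcoset1 Bxx) => xbx'; case/negP: xbx.
  by rewrite -(groupMr _ Bxx) mulgA mulgKV.
have /dcosetP[b1 [b2 [Bb1 Bb2 e]]] := sx.
by rewrite mulgA e -!mulgA mem_dcosetMl // mulgA asc.
Qed.

End Words.
End BNWords.

(** * Standard parabolic subgroups *)

Section BNParabolics.
Local Open Scope group_scope.
Variables (gT : finGroupType) (B N : {group gT}).
Let H := (B :&: N)%G.
Hypothesis nHN : H <| N.
Local Notation dcoset := (dcoset B).
Local Notation reflections := (reflections B N).
Local Notation words := (words B N).
Variable X : {set gT}.
Hypothesis rX : reflections X.
Hypothesis genN : forall n, n \in N -> exists k, n \in words X k.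
Hypothesis genG : <<B :|: N>> = [set: gT].

Let disj : bruhat_disjoint B N := words_bruhat_disjoint nHN rX genN.

Lemma gen_words_dcoset (T : {set gT}) g : reflections T -> g \in <<B :|: T>> ->
  exists n k, n \in words T k /\ g \in dcoset n.
Proof.
move=> rT /gen_prodgP[m [c cT ->]]; elim: m c cT => [|m IH] c cT.
  by exists 1, 0; rewrite big_ord0 /= group1 dcoset_refl.
rewrite big_ord_recl; have [|n [k [kn ngE]]] := IH (fun i => c (lift ord0 i)).
  by move=> i; apply: cT.
have /setUP[Bc|Tc] := cT ord0.
  by exists n, k; rewrite mem_dcosetMl.
have /dcosetP[b [b' [Bb Bb' ->]]] := ngE.
case: (rT) => _ _ _ T4 _.
rewrite !mulgA; case: (T4 _ _ n Tc Bb (words_sub rT kn)) => h.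
  by exists n, k; rewrite mem_dcosetMr.
exists (c ord0 * n), k.+1; rewrite mem_dcosetMr //; split => //.
exact: words_cons.
Qed.

Lemma gen_reflections : <<B :|: X>> = [set: gT].
Proof.
apply/eqP; rewrite eqEsubset subsetT -genG gen_subG subUset sub_gen ?subsetUl //=.
apply/subsetP => n /genN[k]; elim: k n => [|k IH] n.
  by move=> /setIP[Bn _]; rewrite mem_gen // inE Bn.
move=> /mulsgP[x m Xx /IH ? ->]; rewrite groupM //.
by rewrite mem_gen // inE Xx orbT.
Qed.

Lemma bruhat g : exists2 n, n \in N & g \in dcoset n.
Proof.
have : g \in <<B :|: X>> by rewrite gen_reflections inE.
by move=> /(gen_words_dcoset rX)[n [k [/(words_sub rX) ? ?]]]; exists n.
Qed.

(** Let [y] be the first letter of a shortest word for [s] in [T]. As [y] is a descent of [s], some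
    [y * b] keeps [s] in its cell, so [b1^-1 * y * b] equals a conjugate [s * b2 * s^-1]. By
    exchange for [s] the latter lies in [B s^-1 B] or in [B]; hence [y] agrees with [s^-1] up to
    [H]. *)
Lemma reflection_generated (T : {set gT}) s :
  reflections T -> T \subset X -> s \in X -> s \in <<B :|: T>> -> s \in T.
Proof.
move=> rT /subsetP sTX Xs /(gen_words_dcoset rT)[n [k [kn sn]]].
have Nn := words_sub rT kn; have Ns := reflection_N rX Xs.
have exk : exists k, s \in words T k.
  have [h Hh ->] := disj Nn Ns sn; exists k.
  by rewrite (wordsMl rT).
case: (ex_minnP exk) => -[|k'] ks kmin.
  by have /setIP[Bs _] := ks; have := reflection_notB rX Xs; rewrite Bs.
have /mulsgP[y w Ty kw sE] := ks; have Ny := reflection_N rT Ty.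
have asc b : b \in B -> y * b * w \in dcoset (y * w).
  apply: (words_ascent nHN rT disj kw Ty) => j jk; apply/negP; rewrite -sE => /kmin.
  by rewrite leqNgt ltnS (ltnW jk).
have Nw := words_sub rT kw.
have [b Bb] := ascent_descent rT Nw Ty asc.
rewrite -sE => /dcosetP[b1 [b2 [Bb1 Bb2 e]]].
case: (rX) => _ _ _ X4 _.
have := X4 s b2 s^-1 Xs Bb2; rewrite groupV => /(_ Ns).
have -> : s * b2 * s^-1 = b1^-1 * y * b.
  apply: (mulIg s); rewrite mulgKV -[RHS]mulgA -[RHS]mulgA [y * _]mulgA e.
  by rewrite !mulgA mulVg mul1g.
rewrite !(mem_dcosetMr _ _ Bb) !mem_dcosetMl ?groupV // mulgV (dcoset1 (group1 B))
  => -[] h.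
  have [|//|h' Hh' yE] := disj _ _ h; rewrite ?groupV //.
  rewrite -[s]invgK (reflectionV rT) // -[s^-1](mulKg h') -yE.
  by rewrite (reflectionM rT) // groupV.
by have := reflection_notB rT Ty; rewrite h.
Qed.

(** The first letter [x] of a reduced word is a descent, so [x * b * n] is in [B n B] for some [b]
    in [B]. All factors but [x] are known to lie in [M], hence so does [x]. *)
Lemma words_parabolic (M : {group gT}) k n : B \subset M ->
  n \in words X k -> n \in M -> (forall j, j < k -> n \notin words X j) ->
  n \in words (X :&: M) k.
Proof.
move=> sBM; elim: k n => // k IH n /mulsgP[x m Xx km nE] Mn short.
have Nx := reflection_N rX Xx; have Nm := words_sub rX km.
have short' j : j < k -> m \notin words X j.
  move=> jk; apply/negP => jm; have /negP[] := short j.+1 jk.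
  by rewrite nE words_cons.
have asc b : b \in B -> x * b * m \in dcoset (x * m).
  apply: (words_ascent nHN rX disj km Xx) => j jk; rewrite -nE.
  exact/short/ltnW.
have [b Bb] := ascent_descent rX Nm Xx asc.
have /subsetP sBM' := sBM.
rewrite -nE => /dcosetP[b1 [b2 [Bb1 Bb2 e]]].
have Mx : x \in M.
  by rewrite -(groupMr _ (sBM' b Bb)) -(groupMr _ Mn) e;
    rewrite (groupMr _ (sBM' _ Bb2)) (groupMl _ (sBM' _ Bb1)).
rewrite nE; apply: words_cons; first by rewrite inE Xx.
apply: IH => //; by rewrite -(groupMl _ Mx) -nE.
Qed.

Lemma parabolic_dcoset (M : {group gT}) g : B \subset M -> g \in M ->
  exists n k, n \in words (X :&: M) k /\ g \in dcoset n.
Proof.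
move=> sBM Mg; have [n Nn gn] := bruhat g.
case: (ex_minnP (genN Nn)) => k kn kmin; exists n, k; split=> //.
apply: words_parabolic => // [|j jk]; last first.
  by apply/negP => /kmin; rewrite leqNgt jk.
have /subsetP sBM' := sBM.
move: gn => /dcosetP[b [b' [/sBM' Mb /sBM' Mb' gE]]].
by rewrite -(groupMl _ Mb) -(groupMr _ Mb') -gE.
Qed.

(** * Reflections contained in the two maximal parabolic subgroups *)

Section Rank2.

Lemma lie_rank2_sym J K : lie_rank2 B J K -> lie_rank2 B K J.
Proof.
move=> [nJK mx BE]; split; first by rewrite eq_sym.
  by move=> M; apply: (iff_trans (mx M)); split=> -[]; auto.
by rewrite BE setIC.
Qed.

Variables J K : {group gT}.

Lemma rank2_sub : lie_rank2 B J K -> B \subset J.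
Proof. by case=> _ _ ->; rewrite subsetIl. Qed.

Lemma rank2_proper : lie_rank2 B J K -> ~ [set: gT] \subset J.
Proof.
case=> _ mx _; have [/maxgroupp/proper_subn/negP nJ _] := (mx J).2 (or_introl erefl).
exact: nJ.
Qed.

Lemma rank2_maximal (Y : {group gT}) : lie_rank2 B J K -> B \subset Y ->
  [\/ Y :=: [set: gT], Y \subset J | Y \subset K].
Proof.
case=> _ mx _ sBY; have [->|[M maxM sYM]] := maximal_exists (subsetT Y).
  by apply: Or31.
have [|MJ|MK] := (mx M).1; first by split => //; apply: subset_trans sYM.
  by apply: Or32; rewrite -MJ.
by apply: Or33; rewrite -MK.
Qed.

Lemma rank2_exclusive x : lie_rank2 B J K -> x \in X -> x \in J -> x \in K -> False.
Proof.
by move=> [_ _ BE] Xx Jx Kx; have := reflection_notB rX Xx; rewrite BE inE Jx Kx.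
Qed.

End Rank2.

Lemma reflectionsC (s : gT) : s \in X -> reflections (X :\: (H :* s)).
Proof.
move=> Xs; apply: subset_reflections (subsetDl _ _) _ => // h x Hh.
move=> /setDP[Xx xs]; rewrite inE (reflectionM rX) // andbT.
apply: contra xs; rewrite !mem_rcoset -mulgA => ?.
by rewrite -(groupMl _ Hh).
Qed.

Lemma reflections_coset (s : gT) : s \in X -> reflections (H :* s).
Proof.
move=> Xs; apply: (subset_reflections rX); last first.
  by move=> h x Hh; rewrite !mem_rcoset -mulgA => ?; rewrite groupM.
by apply/subsetP => _ /rcosetP[h Hh ->]; rewrite (reflectionM rX).
Qed.

Lemma parabolic_trivial (M : {group gT}) : B \subset M -> X :&: M = set0 -> M :=: B.
Proof.
move=> sBM XM; apply/eqP; rewrite eqEsubset sBM andbT; apply/subsetP => g.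
move=> /(parabolic_dcoset sBM)[n [k [+ gn]]]; rewrite XM.
case: k => [|k] /=; last by move=> /mulsgP[x ?]; rewrite inE.
by move=> /setIP[Bn _]; rewrite -(dcoset1 Bn).
Qed.

(** If [x] were in neither, [B] and [x] would generate the whole group, and every reflection would
    be in [H :* x] by [reflection_generated]. Then [J] and [K] contain no reflection and both equal
    [B]. *)
Lemma rank2_cover J K x : lie_rank2 B J K -> x \in X -> x \in J \/ x \in K.
Proof.
move=> JK Xx; have KJ := lie_rank2_sym JK.
set T := H :* x; have rT := reflections_coset Xx.
have Tx : x \in T by rewrite rcoset_refl.
have sTX : T \subset X.
  by apply/subsetP => _ /rcosetP[h Hh ->]; rewrite (reflectionM rX).
have sBT : B \subset <<B :|: T>> by rewrite sub_gen ?subsetUl.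
have xT : x \in <<B :|: T>> by rewrite mem_gen // inE Tx orbT.
have [Y|/subsetP/(_ x xT)|/subsetP/(_ x xT)] := rank2_maximal JK sBT; auto.
have XT y : y \in X -> y \in T.
  by move=> Xy; apply: reflection_generated => //=; rewrite Y inE.
case Jx: (x \in J); first by left.
case Kx: (x \in K); first by right.
have trivM (M : {group gT}) : B \subset M -> x \notin M -> M :=: B.
  move=> sBM Mx; apply: parabolic_trivial => //; apply/setP=> y; rewrite !inE.
  apply/negP => /andP[/XT/rcosetP[h /setIP[Bh _] ->]].
  by rewrite (groupMl _ (subsetP sBM h Bh)) (negbTE Mx).
have [/eqP[]] := JK; apply/val_inj; rewrite /=.
rewrite (trivM J) ?Jx // ?(rank2_sub JK) //.
by rewrite (trivM K) ?Kx // ?(rank2_sub KJ).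
Qed.

Lemma rank2_exists J K : lie_rank2 B J K -> exists2 x, x \in X & x \in J.
Proof.
move=> JK; have KJ := lie_rank2_sym JK.
have [/existsP[x /andP[? ?]]|none] := boolP [exists x, (x \in X) && (x \in J)].
  by exists x.
case: (rank2_proper KJ); rewrite -gen_reflections gen_subG subUset (rank2_sub KJ).
apply/subsetP => x Xx; have [Jx|//] := rank2_cover JK Xx.
by case/existsP: none; exists x; rewrite Xx.
Qed.

(** Given a reflection [x] of [J] outside [H :* s], the group generated by [B] and all reflections
    outside [H :* s] contains [x] and a reflection of [K], so it lies in neither [K] nor [J]. It is
    then the whole group and contains [s], against [reflection_generated]. *)
Lemma rank2_panel J K : lie_rank2 B J K ->
  exists2 s, s \in X & X :&: J = H :* s.
Proof.
move=> JK; have KJ := lie_rank2_sym JK.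
have [s Xs Js] := rank2_exists JK; have [y Xy Ky] := rank2_exists KJ.
have /subsetP sBJ := rank2_sub JK.
exists s => //; apply/setP=> x; apply/idP/idP; last first.
  move=> /rcosetP[h Hh ->]; rewrite inE (reflectionM rX) // groupM // sBJ //.
  by have /setIP[] := Hh.
move=> /setIP[Xx Jx]; apply/negPn/negP => xs.
set T := X :\: (H :* s); have rT := reflectionsC Xs.
have sgen : s \notin <<B :|: T>>.
  apply/negP => /(reflection_generated rT (subsetDl _ _) Xs).
  by rewrite inE rcoset_refl.
have Tx : x \in <<B :|: T>> by rewrite mem_gen // !inE Xx xs orbT.
have Ty : y \in <<B :|: T>>.
  rewrite mem_gen // !inE Xy andbT (_ : y \notin _) ?orbT //.
  apply/negP => /rcosetP[h /setIP[Bh _] yE].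
  by apply: (rank2_exclusive JK Xy) Ky; rewrite yE groupM // sBJ.
have [Y|/subsetP/(_ y Ty) Jy|/subsetP/(_ x Tx) Kx] :=
  rank2_maximal JK (sub_gen (subsetUl B T)).
- by rewrite Y inE in sgen.
- exact: (rank2_exclusive JK Xy).
- exact: (rank2_exclusive JK Xx).
Qed.

End BNParabolics.

(** * Lengths *)

Section BNLength.
Local Open Scope group_scope.
Variables (gT : finGroupType) (B N : {group gT}).
Let H := (B :&: N)%G.
Hypothesis nHN : H <| N.
Local Notation dcoset := (dcoset B).
Local Notation reflections := (reflections B N).
Local Notation words := (words B N).
Variable X : {set gT}.
Hypothesis rX : reflections X.
Hypothesis genN : forall n, n \in N -> exists k, n \in words X k.

Let disj : bruhat_disjoint B N := words_bruhat_disjoint nHN rX genN.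

(** The second alternative only makes the length total: it is 0 outside [N]. *)
Lemma len_exists n : exists k, (n \in words X k) || (n \notin N).
Proof.
case Nn: (n \in N); last by exists 0; rewrite orbT.
by have [k kn] := genN Nn; exists k; rewrite kn.
Qed.

Definition len n := ex_minn (len_exists n).

Lemma len_words n : n \in N -> n \in words X (len n).
Proof. by rewrite /len; case: ex_minnP => k /orP[//|/negP]. Qed.

Lemma len_le k n : n \in words X k -> len n <= k.
Proof. by rewrite /len; case: ex_minnP => m _ mmin kn; rewrite mmin ?kn. Qed.

Lemma len_short n j : j < len n -> n \notin words X j.
Proof. by rewrite ltnNge; apply: contra => /len_le. Qed.

Lemma lenMl h n : n \in N -> h \in H -> len (h * n) = len n.
Proof.
move=> Nn Hh; have Nh : h \in N by have /setIP[] := Hh.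
apply/eqP; rewrite eqn_leq !len_le //; last by rewrite (wordsMl rX) // len_words.
by rewrite -(wordsMl rX _ _ Hh) len_words ?groupM.
Qed.

Lemma len0 n : n \in N -> len n = 0 -> n \in H.
Proof. by move=> /len_words + n0; rewrite n0. Qed.

Lemma len_gt n x : x \in X -> n \in N -> len n <= (len (x * n)).+1.
Proof.
move=> Xx Nn; apply/len_le/(words_uncons rX Xx)/len_words.
by rewrite groupM ?(reflection_N rX Xx).
Qed.

Lemma len_ascent n x b : n \in N -> x \in X -> b \in B -> len n <= len (x * n) ->
  x * b * n \in dcoset (x * n).
Proof.
move=> Nn Xx Bb le; apply: (words_ascent nHN rX disj (len_words Nn)) => // j jn.
exact/len_short/(leq_trans jn).
Qed.

(** With equal lengths, both steps, from [n] to [x * n] and back, would be ascents. The first lets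
    some [x * b * (x * n)] stay in the cell of [x * n]; the second moves it to the cell of [n]. *)
Lemma len_neq n x : n \in N -> x \in X -> len (x * n) != len n.
Proof.
move=> Nn Xx; apply/eqP => xn; have Nx := reflection_N rX Xx.
have [b Bb desc] : exists2 b, b \in B & x * b * (x * n) \in dcoset (x * n).
  by apply: (ascent_descent rX) => // b Bb; rewrite len_ascent ?xn.
have Bxx : x * x \in B by have /setIP[] := reflection_sqr rX Xx.
have [] := negP (reflection_dcosetN rX disj Xx Nn).
apply: dcoset_trans (_ : x * b * (x * n) \in dcoset n); first by rewrite dcoset_sym.
have -> : x * b * (x * n) = x^-1 * (x * x * b) * (x * n) by rewrite !mulgA mulVg
  mul1g.
rewrite -[n in dcoset n](mulKg x);
  apply: (len_ascent (groupM Nx Nn) (reflectionV rX Xx) (groupM Bxx Bb)).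
by rewrite mulKg xn.
Qed.

Lemma len_descent n : n \in N -> 0 < len n ->
  exists2 x, x \in X & len (x * n) < len n.
Proof.
move=> Nn; have := len_words Nn; case: (len n) => // k kn _.
have /mulsgP[x m Xx km ->] := kn.
by exists x^-1; rewrite ?(reflectionV rX) // mulKg ltnS len_le.
Qed.

(* An element fixing the chambers [B] and [B m] fixes every chamber on a
   minimal gallery between them. *)
Lemma len_stab m x u : m \in N -> x \in X -> len (x * m) < len m ->
  u \in B -> m * u * m^-1 \in B -> (x * m) * u * (x * m)^-1 \in B.
Proof.
move=> Nm Xx lt Bu Bb; have Nx := reflection_N rX Xx.
set b := _ * _ in Bb; case: (rX) => _ _ _ X4 _.
have -> : x * m * u * (x * m)^-1 = x * b * x^-1 by rewrite invMg /b !mulgA.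
have [|h|] := X4 x b x^-1 Xx Bb; rewrite ?groupV //; last by rewrite mulgV dcoset1.
(* In the other case of the exchange, the ascent from [x * m] to [m] puts [x * m * u] in the cell of
   [m], although [u] in [B] keeps it in the cell of [x * m]. *)
have [] := negP (reflection_dcosetN rX disj Xx Nm).
have /dcosetP[b1 [b2 [Bb1 Bb2 e]]] := h.
apply: dcoset_trans (_ : x * m * u \in dcoset m).
  by rewrite dcoset_sym mem_dcosetMr ?dcoset_refl.
have -> : x * m * u = b1 * (x^-1 * b2 * (x * m)).
  by rewrite !mulgA -e /b !mulgA !mulgKV.
rewrite mem_dcosetMl // -[m in dcoset m](mulKg x).
apply: (len_ascent (groupM Nx Nm) (reflectionV rX Xx) Bb2).
by rewrite mulKg ltnW.
Qed.

(** * The longest element of the Weyl group *)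

Section Longest.
Variables s t : gT.
Hypotheses (Xs : s \in X) (Xt : t \in X).
Hypothesis sXst : X \subset (H :* s) :|: (H :* t).
Variable n : gT.
Hypotheses (Nn : n \in N) (sn : len (s * n) < len n) (tn : len (t * n) < len n).

Let gen (e : bool) := if e then s else t.

(* Multiplying [n] on the left alternately by [s] and [t] runs down one of the
   two reduced words of the longest element. *)
Fixpoint descend e i := if i is j.+1 then gen (e (+) odd j) * descend e j else n.

Lemma gen_refl e : gen e \in X. Proof. by case: e. Qed.

Lemma gen_cover x : x \in X -> exists e h, h \in H /\ x = h * gen e.
Proof.
move=> /(subsetP sXst)/setUP[] /rcosetP[h Hh ->]; first by exists true, h.
by exists false, h.
Qed.

Lemma descend_N e i : descend e i \in N.
Proof. by elim: i => //= i IH; rewrite groupM // (reflection_N rX) ?gen_refl. Qed.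

Lemma len_gen_gen e m : m \in N -> len (gen e * (gen e * m)) = len m.
Proof. by move=> Nm; rewrite mulgA lenMl // (reflection_sqr rX) ?gen_refl. Qed.

(** While the length is positive some letter is a descent. It is not the letter just used, which
    would lead back up, so it is the other one. *)
Lemma len_descend e i : i <= len n -> len (descend e i) = len n - i.
Proof.
elim/ltn_ind: i => -[|i] ih lt; first by rewrite subn0.
have IH := ih i (ltnSn i) (ltnW lt); have Nd := descend_N e i.
suff: len (descend e i.+1) < len (descend e i).
  move=> lt'; have := len_gt (gen_refl (e (+) odd i)) Nd; rewrite -/(descend e i.+1).
  move=> le; apply/eqP; rewrite -(eqn_add2r i.+1) subnK // addnS -addSn.
  have -> : (len (descend e i.+1)).+1 = len (descend e i) by apply/eqP;
    rewrite eqn_leq lt' le.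
  by rewrite IH subnK // ltnW.
case: i => [|i] in ih lt IH Nd *; first by rewrite /=; case: e {ih IH Nd}.
have [x Xx desc] : exists2 x,
  x \in X & len (x * descend e i.+1) < len (descend e i.+1).
  by apply: len_descent => //; rewrite IH subn_gt0.
have [e' [h [Hh xE]]] := gen_cover Xx; move: desc;
  rewrite xE {xE Xx} -mulgA lenMl //; last first.
  by rewrite groupM // (reflection_N rX) ?gen_refl.
have [->//|] := eqVneq e' (e (+) odd i.+1).
rewrite [odd _]/= addbN => e'E; have -> : e' = e (+) odd i.
  by move: e'E; case: e'; case: (e (+) odd i).
rewrite [descend e i.+1]/= len_gen_gen ?descend_N // -/(descend e i.+1) IH.
rewrite ih //; lia.
Qed.

Lemma descend_stab e i u : i <= len n -> u \in B -> n * u * n^-1 \in B ->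
  descend e i * u * (descend e i)^-1 \in B.
Proof.
elim: i => // i IH lt Bu fix_n.
rewrite len_stab ?descend_N ?gen_refl ?IH ?(ltnW lt) //.
rewrite -/(descend e i.+1) !len_descend ?(ltnW lt) //; lia.
Qed.

(** A letter put in front of [descend e i] either continues the descent or undoes its last step; at
    the two ends, [i = 0] and [i = len n], it passes to the other branch. *)
Lemma descend_cover k m : m \in words X k ->
  exists e i h, [/\ i <= len n, h \in H & m = h * descend e i].
Proof.
have last_H e : descend e (len n) \in H.
  by rewrite len0 ?descend_N // len_descend ?subnn.
elim: k m => [|k IH] m.
  move=> Hm; exists true, (len n), (m * (descend true (len n))^-1).
  by rewrite mulgKV groupM ?groupV.
move=> /mulsgP[x m' Xx /IH[e [i [h [lt Hh ->]]]] ->].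
have [e' [h' [Hh' ->]]] := gen_cover Xx.
have [h'' Hh'' e'h] := HN_swap nHN (reflection_N rX (gen_refl e')) Hh.
rewrite !mulgA -[h' * _ * _]mulgA e'h mulgA.
have Hhh := groupM Hh' Hh''; move: (h' * h'') Hhh => {h h' h'' Hh Hh' Hh'' e'h} h Hh.
have Hgg : gen e' * gen e' \in H by rewrite (reflection_sqr rX) ?gen_refl.
have [e'E|e'E] := eqVneq e' (e (+) odd i); last first.
  case: i => [|i] in lt e'E *.
    exists (~~ e), 1%N, h; rewrite (leq_ltn_trans _ sn) //; split=> //.
    by rewrite -mulgA /= addbF; congr (_ * (gen _ * _)); move: e'E; clear; case: e;
      case: e'.
  exists e, i, (h * (gen e' * gen e')); rewrite ltnW ?(groupM Hh Hgg) //; split=> //.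
  rewrite [descend e i.+1]/= !mulgA; congr (_ * gen _ * _).
  by move: e'E; clear; rewrite [odd _]/= addbN; case: e'; case: (e (+) _).
move: lt; rewrite leq_eqVlt => /predU1P[iE|lt]; last first.
  by exists e, i.+1, h; rewrite lt /= mulgA -e'E.
(* At the bottom both branches have reached [H], so the next letter climbs the other branch by one
   step. *)
have [k' kE] : exists k', len n = k'.+1.
  by exists (len n).-1; rewrite prednK // (leq_ltn_trans _ sn).
have He := last_H e; have := last_H (~~ e); rewrite {1}kE [descend _ k'.+1]/= => Hne.
have e'E' : e' = ~~ e (+) odd k' by rewrite e'E iE kE /= addbN addNb.
rewrite -e'E' in Hne; set c := descend e i * (gen e' * descend (~~ e) k')^-1.
have Hc : c \in H by rewrite groupM ?groupV // iE.
have [c' Hc' cE] := HN_swap nHN (reflection_N rX (gen_refl e')) Hc.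
exists (~~ e), k', (h * c' * (gen e' * gen e'));
  rewrite kE leqnSn (groupM (groupM Hh Hc') Hgg); split=> //.
rewrite [RHS](_ : _ = h * (c' * gen e') * (gen e' * descend (~~ e) k')).
  by rewrite -cE /c -!mulgA mulVg mulg1.
by rewrite !mulgA.
Qed.

(** Every chamber [B m] of the apartment lies on a minimal gallery from [B n] to [B], namely one of
    the two branches, and is therefore fixed together with its ends. *)
Lemma longest_stab u m : u \in B -> n * u * n^-1 \in B -> m \in N ->
  m * u * m^-1 \in B.
Proof.
move=> Bu fix_n /genN[k /descend_cover[e [i [h [lt /setIP[Bh _] ->]]]]].
have -> : h * descend e i * u * (h * descend e i)^-1 = h * (descend e i * u *
  (descend e i)^-1) * h^-1.
  by rewrite invMg !mulgA.
by apply: groupM; rewrite ?groupV //; apply: groupM => //; apply: descend_stab.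
Qed.

End Longest.
End BNLength.

(** * Groups with a split BN-pair of rank two *)

Section Facts.
Local Open Scope group_scope.
Variable gT : finGroupType.

(** [X] consists of all lifts of the elements of [S]. The axiom that [s B s] differs from [B] turns
    into a conjugate [x * b * x^-1] outside [B]: if there were none, then [x * x \in H] would give
    [s B s = B]. *)
Lemma BN_pair_reflections (B N : {group gT}) : BN_pair B N ->
  exists X, [/\ B :&: N <| N, reflections B N X,
    forall n, n \in N -> exists k, n \in words B N X k
    & <<B :|: N>> = [set: gT]].
Proof.
set H := (B :&: N)%G; move=> [genG nHN [S [genS S2 S3 S4]]].
have NN n : n \in N -> n \in 'N(H) by apply: (subsetP (normal_norm nHN)).
have NnB n : n \in N -> B * (H :* n) * B = dcoset B n.
  move=> Nn; rewrite /dcoset mulgA (mulGSid (subsetIl B N)) //.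
pose X := [set x in N | coset H x \in S].
have XN x : x \in X -> x \in N by rewrite inE => /andP[].
have HX h x : h \in H -> x \in X -> h * x \in X.
  move=> Hh; rewrite !inE => /andP[Nx Sx]; have Nh : h \in N by have /setIP[] := Hh.
  by rewrite groupM // (coset_morphM (NN _ Nh) (NN _ Nx)) (coset_id Hh) mul1g.
have XX x : x \in X -> x * x \in H.
  rewrite inE => /andP[Nx Sx]; apply: coset_idr; first by rewrite groupM ?NN.
  by rewrite (coset_morphM (NN _ Nx) (NN _ Nx)) -expg2 -(S2 _ Sx) expg_order.
exists X; split=> //; first split=> //.
- move=> x Xx; split; first exact: XN.
  apply/negP => Bx; have Hx : x \in H by rewrite inE Bx XN.
  move: Xx; rewrite inE (coset_id Hx) => /andP[_ S1].
  by have := S2 _ S1; rewrite order1.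
- move=> x b n; rewrite inE => /andP[Nx Sx] Bb Nn.
  have qn : coset H n \in N / H by rewrite mem_quotient.
  have /subsetP/(_ (x * b * n)) := S3 _ _ Sx qn.
  rewrite -coset_morphM ?NN // !val_coset ?groupM ?NN // !NnB ?groupM //.
  have xbn : x * b * n \in H :* x * B * (H :* n) by rewrite !mem_mulg ?rcoset_refl.
  by move=> /(_ xbn)/setUP.
- move=> x Xx; apply/exists_inP; apply: contraT.
  rewrite negb_exists_in => /forall_inP h; have {}h b : b \in B -> x * b * x^-1 \in B.
    by move/h; rewrite negbK.
  move: (Xx); rewrite inE => /andP[Nx Sx]; have /eqP[] := S4 _ Sx.
  have /setIP[Bxx _] := XX _ Xx.
  rewrite !val_coset ?NN //; apply/setP=> g; apply/idP/idP.
    move=> /mulsgP[y z /mulsgP[y' b /rcosetP[h1 /setIP[Bh1 _] ->] Bb ->]].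
    move=> /rcosetP[h2 /setIP[Bh2 _] ->] ->.
    have -> : h1 * x * b * (h2 * x) = h1 * (x * (b * h2) * x^-1) * (x * x).
      by rewrite !mulgA mulgKV.
    by rewrite groupM // groupM // h ?groupM.
  move=> Bg; have -> : g = x * (x^-1 * g * x^-1) * x by rewrite !mulgA mulgV mul1g
    mulgKV.
  rewrite !mem_mulg ?rcoset_refl //.
  have -> : x^-1 * g * x^-1 = (x * x)^-1 * (x * g * x^-1).
    by rewrite invMg !mulgA mulgKV.
  by rewrite groupM ?groupV ?h.
- move=> n Nn; have : coset H n \in <<S>> by rewrite genS mem_quotient.
  move=> /gen_prodgP[m [c Sc nE]]; exists m.
  elim: m n Nn c Sc nE => [|m IH] n Nn c Sc.
    by rewrite big_ord0 => /(coset_idr (NN _ Nn)).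
  rewrite big_ord_recl => nE.
  have : c ord0 \in N / H by rewrite -genS mem_gen.
  move=> /morphimP[x _ Nx cE].
  apply/mulsgP; exists x (x^-1 * n); last by rewrite mulKVg.
    by rewrite inE Nx -cE Sc.
  apply: (IH _ _ (fun i => c (lift ord0 i))) => //; first by rewrite groupM ?groupV.
  by rewrite coset_morphM ?groupV ?NN // morphV ?NN //= nE cE mulKg.
Qed.

(** For a Borel subgroup [B], both sides say that [A] fixes the chamber [B x]. *)
Lemma sub_conjgP (A B : {set gT}) x :
  reflect {in A, forall u, x * u * x^-1 \in B} (A \subset B :^ x).
Proof.
apply: (iffP subsetP) => h u /h; first by rewrite mem_conjg conjgE invgK mulgA.
by rewrite mem_conjg conjgE invgK mulgA.
Qed.

End Facts.

(** * A panel: the rank one parabolic subgroup [J] *)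

Section Panel.
Local Open Scope group_scope.
Variables (gT : finGroupType) (B N J K : {group gT}) (X : {set gT}) (s : gT).
Let H := (B :&: N)%G.
Hypotheses (nHN : H <| N) (rX : reflections B N X).
Hypothesis genN : forall n, n \in N -> exists k, n \in words B N X k.
Hypothesis genG : <<B :|: N>> = [set: gT].
Hypothesis JK : lie_rank2 B J K.
Hypotheses (Xs : s \in X) (XJ : X :&: J = H :* s).

Local Notation dcoset := (dcoset B).

Lemma panel_reflection : s \in J.
Proof. by have := rcoset_refl H s; rewrite -XJ => /setIP[]. Qed.

Lemma panel_words k n : n \in words B N (H :* s) k -> n \in H \/ n \in H :* s.
Proof.
elim: k n => [|k IH] n; first by left.
move=> /mulsgP[y m /rcosetP[h Hh ->] /IH[Hm|/rcosetP[h' Hh' ->]] ->].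
  have [h' Hh' e] := HN_swap nHN (reflection_N rX Xs) Hm.
  by right; rewrite -mulgA e mulgA mem_rcoset mulgK groupM.
have [h'' Hh'' e] := HN_swap nHN (reflection_N rX Xs) Hh'.
left; rewrite mulgA -[h * s * h']mulgA e -!mulgA groupM // groupM //.
exact: (reflection_sqr rX).
Qed.

Lemma panel_dcoset g : g \in J -> g \in B \/ g \in dcoset s.
Proof.
move=> /(parabolic_dcoset nHN rX genN genG (rank2_sub JK))[n [k [+ gn]]].
rewrite XJ => /panel_words[/setIP[Bn _]|/rcosetP[h /setIP[Bh _] nE]].
  by left; rewrite -(dcoset1 Bn).
by right; apply: dcoset_trans gn _; rewrite nE mem_dcosetMl ?dcoset_refl.
Qed.

Lemma panel_N n : n \in N -> n \in J -> n \in H \/ n \in H :* s.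
Proof.
move=> Nn Jn; apply: (@panel_words (len genN n)); rewrite -XJ.
apply: (words_parabolic nHN rX genN (rank2_sub JK)) => //; first exact: len_words.
by move=> j; apply: len_short.
Qed.

(** [J] is the union of [B] and [B s B], so any element of [Y] outside [B] brings [s] with it. *)
Lemma panel_overgroup (Y : {group gT}) : B \subset Y -> Y \subset J ->
  Y :=: B \/ Y :=: J /\ s \in Y.
Proof.
move=> sBY sYJ; have [sYB|/subsetPn[y Yy By]] := boolP (Y \subset B).
  by left; apply/eqP; rewrite eqEsubset sYB.
have [|/dcosetP[b [b' [Bb Bb' yE]]]] := panel_dcoset (subsetP sYJ y Yy).
  by move=> By'; rewrite By' in By.
have Ys : s \in Y.
  have -> : s = b^-1 * y * b'^-1 by rewrite yE !mulgA mulVg mul1g mulgK.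
  by rewrite !(groupM, groupV) ?(subsetP sBY _ Bb) ?(subsetP sBY _ Bb').
right; split=> //; apply/eqP; rewrite eqEsubset sYJ; apply/subsetP=> g.
move=> /panel_dcoset[/(subsetP sBY)//|/dcosetP[c [c' [Bc Bc' ->]]]].
by rewrite !(groupM, groupV) ?(subsetP sBY _ Bc) ?(subsetP sBY _ Bc').
Qed.

End Panel.

(** * Unipotent radicals and chambers fixed by a p-subgroup *)

Section Rank2.
Local Open Scope group_scope.
Variables (gT : finGroupType) (p : nat) (B N J K U : {group gT}) (X : {set gT}) (s
  t : gT).
Let H := (B :&: N)%G.
Hypotheses (nHN : H <| N) (rX : reflections B N X).
Hypothesis genN : forall n, n \in N -> exists k, n \in words B N X k.
Hypothesis genG : <<B :|: N>> = [set: gT].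
Hypothesis JK : lie_rank2 B J K.
Hypotheses (Xs : s \in X) (XJ : X :&: J = H :* s).
Hypotheses (Xt : t \in X) (XK : X :&: K = H :* t).

Local Notation dcoset := (dcoset B).
Let disj : bruhat_disjoint B N := words_bruhat_disjoint nHN rX genN.
Let KJ := lie_rank2_sym JK.

Hypothesis HE : \bigcap_(n in N) (B :^ n) = H.
Hypotheses (UHB : U ><| H = B) (pU : p.-group U) (p'H : p^'.-group H).

Let nUB : U <| B. Proof. by have [] := sdprod_context UHB. Qed.
Let UH : U * H = B. Proof. by have [] := sdprod_context UHB. Qed.
Let sUB : U \subset B. Proof. exact: normal_sub. Qed.

(** As [x] normalizes [H], it would normalize [U * H = B]. Since every subgroup properly containing
    [B] contains a reflection, this yields ['N(U) = B]. *)
Lemma reflection_norm_unipotent x : x \in X -> x \notin 'N(U).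
Proof.
move=> Xx; apply/negP => nUx; case: (rX) => _ _ _ _ X5.
have [b Bb /negP[]] := X5 x Xx.
have nHx : x \in 'N(H) by rewrite (subsetP (normal_norm nHN)) ?(reflection_N rX).
have nBx : x \in 'N(B) by rewrite -UH; apply/normP;
  rewrite conjsMg (normP nUx) (normP nHx).
by rewrite -[x in x * b]invgK -mulgA -conjgE memJ_norm ?groupV.
Qed.

Lemma unipotent_neq1 : U :!=: 1.
Proof.
apply/eqP => U1; have := reflection_norm_unipotent Xs.
by rewrite U1 norm1 inE.
Qed.

Lemma p_subgroup_Borel (P : {group gT}) : p.-group P -> P \subset B -> P \subset U.
Proof.
move=> pP sPB; rewrite (@sub_normal_Hall _ p B) //.
by rewrite /pHall sUB pU -divgS // -(sdprod_card UHB) mulKn.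
Qed.

(** [N :&: J] is the union of [H] and [H :* s], and [H] normalizes [U], so the intersection has only
    two distinct terms. *)
Lemma panel_radical :
  (forall P : {group gT}, B \subset P -> \bigcap_(n in N :&: P) (U :^ n) <| P) ->
  U :&: U :^ s <| J.
Proof.
move=> /(_ J (rank2_sub JK)); set I := \bigcap_(n in _) _;
  suff -> : I = U :&: U :^ s by [].
have HnU h : h \in H -> U :^ h = U.
  by move=> /setIP[Bh _]; apply/normP; apply: (subsetP (normal_norm nUB)).
have Js := panel_reflection XJ.
apply/eqP; rewrite eqEsubset; apply/andP; split; last first.
  apply/bigcapsP => n /setIP[Nn Jn]; have [Hn|] := panel_N nHN rX genN JK Xs XJ Nn Jn.
    by rewrite (HnU n Hn) subsetIl.
  by move=> /rcosetP[h Hh ->]; rewrite conjsgM (HnU h Hh) subsetIr.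
rewrite subsetI; apply/andP; split.
  by apply: (bigcap_min 1); rewrite ?group1 // conjsg1.
by apply: (bigcap_min s); rewrite // inE Js (reflection_N rX).
Qed.

(* If it were trivial, [H] would be the common stabilizer of [B] and [B s]; as
   this stabilizer is transitive on the chambers other than [B s] of the panel
   of type [t] of [B s], that panel would have only two chambers. *)
Lemma panel_radical_neq1 : U :&: U :^ s != 1.
Proof.
have Ns := reflection_N rX Xs; have Nt := reflection_N rX Xt.
have [_ _ BE] := JK.
have sBJ := subsetP (rank2_sub JK); have sBK := subsetP (rank2_sub KJ).
have Kt := panel_reflection XK.
apply/eqP => UU1; have fixH u : u \in B -> s * u * s^-1 \in B -> u \in H.
  move=> Bu Bsu; pose D := (B :&: B :^ s)%G.
  have sHD : H \subset D.
    rewrite subsetI subsetIl -(normsP (normal_norm nHN) s Ns) conjSg.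
    exact: subsetIl.
  have DE : (D :&: U) * H = D by rewrite group_modr // UH; apply/setIidPl/subsetIl.
  (* Conjugated back by [s], this p-subgroup lies in [B] and hence in [U]; so it is contained in
     [U :^ s] too. *)
  have DU1 : D :&: U = 1.
    apply/trivgP; rewrite -UU1 subsetI subsetIr /= -sub_conjgV p_subgroup_Borel //.
      by rewrite pgroupJ (pgroupS (subsetIr _ _)).
    by rewrite sub_conjgV subIset // subsetIr.
  by rewrite -[_ \in _]/(u \in gval H) -[gval H]mul1g -DU1 DE inE Bu mem_conjg
    conjgE invgK mulgA.
case: (rX) => _ _ _ _ X5; have [b Bb /negP[]] := X5 t Xt.
have ts : t * s \notin words B N X 0.
  apply/negP => /setIP[/sBJ]; rewrite groupMr ?(panel_reflection XJ) // => Jt.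
  by case: (rank2_exclusive rX JK Xt).
have := words_ascent nHN rX disj (words1 B N Xs) Xt _ Bb.
move=> /(_ _)/dcosetP[]; first by case.
move=> b1 [b2 [Bb1 Bb2 e]].
(* [s * b2 * s^-1] is in [J] as written, and in [K] by the equation [e], hence in [B]. Then [b2],
   being in [H], can be moved across [t * s], which forces [t * b * t^-1] into [B]. *)
have Hb2 : b2 \in H.
  have sb2 : s * b2 * s^-1 = t^-1 * b1^-1 * t * b.
    apply: (mulIg s); rewrite mulgKV -!mulgA [t * (b * s)]mulgA e -!mulgA.
    by rewrite mulKg mulKg.
  apply: fixH => //; rewrite BE inE; apply/andP; split.
    by rewrite !groupM ?groupV ?(panel_reflection XJ) ?(sBJ b2).
  by rewrite sb2 !groupM ?groupV ?(sBK b1) ?(sBK b).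
have [h /setIP[Bh _] e'] := HN_swap nHN (groupM Nt Ns) Hb2.
have -> : t * b * t^-1 = b1 * h.
  apply: (mulIg t); rewrite mulgKV; apply: (mulIg s).
  by rewrite e -(mulgA b1 (t * s)) e' !mulgA.
by rewrite groupM.
Qed.

Lemma rank2_overgroup (Y : {group gT}) : B \subset Y ->
  [\/ Y :=: B, Y :=: J | Y :=: [set: gT]] \/ Y \subset K.
Proof.
move=> sBY; have [->|sYJ|sYK] := rank2_maximal JK sBY; last by right.
  by left; apply: Or33.
by left; have [->|[-> _]] := panel_overgroup nHN rX genN genG JK Xs XJ sBY sYJ;
  [apply: Or31|apply: Or32].
Qed.

(** The default is never reached, by the Bruhat decomposition. [cell_len (x * g^-1)] is the gallery
    distance between the chambers [B g] and [B x]. *)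
Definition cell_rep g := odflt 1 [pick n in N | g \in dcoset n].
Definition cell_len g := len genN (cell_rep g).

Lemma cell_lenE g n : n \in N -> g \in dcoset n -> cell_len g = len genN n.
Proof.
rewrite /cell_len /cell_rep => Nn gn; case: pickP => [m /andP[Nm gm]|/(_ n)];
  last first.
  by rewrite /= Nn gn.
have [h Hh ->] : exists2 h, h \in H & m = h * n.
  apply: disj => //; apply: dcoset_trans gn; by rewrite dcoset_sym.
by rewrite /= (lenMl rX).
Qed.

Lemma reflections_cover : X \subset (H :* s) :|: (H :* t).
Proof.
apply/subsetP => x Xx; rewrite -XJ -XK !inE Xx /=.
by have [->|->] := rank2_cover nHN rX genN genG JK Xx; rewrite ?orbT.
Qed.

(** Connectedness in the form of an induction principle. If [x * g^-1] is in the cell of [n] and [y]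
    is a descent of [n], then [B y n b' g] is the chamber next to [B x] on a minimal gallery towards
    [B g]; by [len_stab] it is fixed by whatever fixes both ends. *)
Lemma fixed_chamber_ind (P : {group gT}) (C : gT -> Prop) g x :
  P \subset B :^ g -> C g ->
  (forall y z, C y -> P \subset B :^ z -> (z * y^-1 \in J \/ z * y^-1 \in K) ->
    C z) ->
  P \subset B :^ x -> C x.
Proof.
move=> /sub_conjgP fg Cg CS; have [n Nn] := bruhat rX genN genG (x * g^-1).
have [k] := ubnP (len genN n).
elim: k n x Nn => // k IH n x Nn ltk /dcosetP[b [b' [Bb Bb' xE]]] Px.
have xE' : x = b * n * b' * g by rewrite -xE mulgKV.
have [n0|n_gt0] := posnP (len genN n).
  have /setIP[Bn _] := len0 Nn n0; apply: CS Cg Px _; left; rewrite xE.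
  by apply: (subsetP (rank2_sub JK)); apply: groupM => //; apply: groupM.
have [y Xy lty] := len_descent rX Nn n_gt0; have Ny := reflection_N rX Xy.
apply: (CS (y * n * b' * g) x _ Px); last first.
  have -> : x * (y * n * b' * g)^-1 = b * y^-1 by rewrite xE' !invMg !mulgA !mulgK.
  have [sBJ sBK] := (subsetP (rank2_sub JK) b Bb, subsetP (rank2_sub KJ) b Bb).
  have [Jy|Ky] := rank2_cover nHN rX genN genG JK Xy; [left|right].
    by rewrite groupM ?groupV.
  by rewrite groupM ?groupV.
apply: (IH (y * n)); first by rewrite groupM.
- by apply: leq_trans lty _.
- by rewrite mulgK; apply/dcosetP; exists 1, b'; rewrite mul1g group1.
apply/sub_conjgP => u Pu; move/sub_conjgP: Px => fx.
set u' := b' * (g * u * g^-1) * b'^-1.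
have Bu' : u' \in B by rewrite groupMr ?groupV // groupMl // fg.
have -> : y * n * b' * g * u * (y * n * b' * g)^-1 = y * n * u' * (y * n)^-1.
  by rewrite /u' !invMg !mulgA.
apply: (len_stab nHN rX Nn Xy lty Bu').
have -> : n * u' * n^-1 = b^-1 * (x * u * x^-1) * b.
  by rewrite xE' /u' !invMg !mulgA mulVg mul1g mulgKV.
by rewrite groupMr ?groupV // groupMl ?groupV // fx.
Qed.

(* Two opposite chambers have no nontrivial p-subgroup in their common
   stabilizer; a chamber of [E] at maximal distance from another one is
   opposite to it unless it has a panel without further chambers of [E]. *)
Lemma fixed_chamber_extremal (P : {group gT}) (E : {set gT}) g :
  p.-group P -> P :!=: 1 -> {in E, forall x, P \subset B :^ x} -> g \in E ->
  exists2 x, x \in E &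
    (forall z, z \in E -> z * x^-1 \in J -> z * x^-1 \in B) \/
    (forall z, z \in E -> z * x^-1 \in K -> z * x^-1 \in B).
Proof.
move=> pP P1 EP Eg.
case: (@arg_maxnP _ g (mem E) (fun x => cell_len (x * g^-1)) Eg) => x Ex xmax.
have [n Nn xn] := bruhat rX genN genG (x * g^-1).
have xlen := cell_lenE Nn xn; have /dcosetP[c [c' [Bc Bc' xE]]] := xn.
(* If [r] were an ascent of [n], the chamber [B z] would be farther from [B g] than [B x] is. *)
exists x => //; have step r z : r \in X -> z \in E -> z * x^-1 \in dcoset r ->
    len genN (r * n) < len genN n.
  move=> Xr Ez /dcosetP[b [b' [Bb Bb' zE]]].
  rewrite ltn_neqAle (len_neq nHN rX) //= leqNgt; apply/negP => asc.
  have := xmax z Ez; rewrite /= xlen leqNgt => /negP[].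
  suff zn : z * g^-1 \in dcoset (r * n).
    by rewrite (cell_lenE _ zn) // groupM // (reflection_N rX).
  have -> : z * g^-1 = b * (r * (b' * c) * n) * c'.
    have -> : z * g^-1 = z * x^-1 * (x * g^-1) by rewrite mulgA mulgKV.
    by rewrite zE xE !mulgA.
  rewrite (mem_dcosetMr _ _ Bc') (mem_dcosetMl _ _ Bb).
  apply: (len_ascent nHN rX (genN := genN)) => //; first by rewrite groupM.
  exact: ltnW.
have [/existsP[z /and3P[Ez Jz Bz]]|noJ] :=
  boolP [exists z, [&& z \in E, z * x^-1 \in J & z * x^-1 \notin B]]; last first.
  left=> z Ez Jz; apply/negPn/negP => Bz; case/existsP: noJ; exists z; exact/and3P.
right=> w Ew Kw; apply/negPn/negP => Bw.
have sn : len genN (s * n) < len genN n.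
  by apply: step Xs Ez _; have [Bz'|//] :=
    panel_dcoset nHN rX genN genG JK Xs XJ Jz; rewrite Bz' in Bz.
have tn : len genN (t * n) < len genN n.
  by apply: step Xt Ew _; have [Bw'|//] :=
    panel_dcoset nHN rX genN genG KJ Xt XK Kw; rewrite Bw' in Bw.
(* Both reflections are descents of [n], so a conjugate [u'] of [u] fixes all chambers of an
   apartment and lies in [H], a p'-group. *)
have cov := reflections_cover.
case/trivgPn: P1 => u Pu /eqP[].
set u' := c' * (g * u * g^-1) * c'^-1.
have Bu' : u' \in B by rewrite groupMr ?groupV // groupMl // (sub_conjgP _ _ _ (EP
  g Eg)).
have Bnu' : n * u' * n^-1 \in B.
  have -> : n * u' * n^-1 = c^-1 * (x * u * x^-1) * c.
    have -> : x = c * n * c' * g by rewrite -xE mulgKV.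
    by rewrite /u' !invMg !mulgA mulVg mul1g mulgKV.
  by rewrite groupMr ?groupV // groupMl ?groupV // (sub_conjgP _ _ _ (EP x Ex)).
have Hu' : u' \in H.
  rewrite -[_ \in H]/(u' \in gval H) -HE; apply/bigcapP => m Nm.
  rewrite mem_conjg conjgE invgK mulgA.
  exact: (longest_stab nHN rX Xs Xt cov Nn sn tn).
have u'E : u' = u ^ (c' * g)^-1 by rewrite conjgE /u' !invMg !invgK !mulgA.
have : #[u'] = 1%N.
  apply/eqP; rewrite -dvdn1 -(eqP (pnat_coprime (_ : p.-nat #[u']) (_ : p^'.-nat
    #[u']))).
  - by rewrite dvdn_gcd !dvdnn.
  - by rewrite u'E orderJ; apply: mem_p_elt Pu.
  - exact: mem_p_elt Hu'.
by rewrite u'E orderJ => /eqP; rewrite order_eq1 => /eqP.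
Qed.

End Rank2.

(** * Summary of the group theory *)

Section Parabolics.
Local Open Scope group_scope.
Variable gT : finGroupType.

(** Together with [lie_rank2], these are the facts on the BN-pair that the geometric part uses.
    Chambers [B x] are given by representatives [x], so [C] and [E] are a property and a set of
    group elements. *)
Record rank2_parabolics (p : nat) (B J K U : {group gT}) : Prop := Rank2Parabolics {
  parab_overgroup (Y : {group gT}) :
    B \subset Y -> [\/ Y :=: B, Y :=: J, Y :=: K | Y :=: [set: gT]];
  parab_radical : exists Q : {group gT}, [/\ p.-group Q, Q :!=: 1 & Q <| J];
  parab_radical2 : exists Q : {group gT}, [/\ p.-group Q, Q :!=: 1 & Q <| K];
  parab_Sylow : p.-Sylow([set: gT]) U;
  parab_neq1 : U :!=: 1;
  parab_norm : 'N(U) = B;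
  parab_connected (P : {group gT}) (C : gT -> Prop) g x :
    P \subset B :^ g -> C g ->
    (forall y z, C y -> P \subset B :^ z ->
      (z * y^-1 \in J \/ z * y^-1 \in K) -> C z) ->
    P \subset B :^ x -> C x;
  parab_extremal (P : {group gT}) (E : {set gT}) g :
    p.-group P -> P :!=: 1 -> {in E, forall x, P \subset B :^ x} -> g \in E ->
    exists2 x, x \in E &
      (forall z, z \in E -> z * x^-1 \in J -> z * x^-1 \in B) \/
      (forall z, z \in E -> z * x^-1 \in K -> z * x^-1 \in B)
}.

Lemma split_BN_pair_parabolics (p : nat) (B N J K : {group gT}) :
  split_BN_pair p B N -> lie_rank2 B J K -> exists U, rank2_parabolics p B J K U.
Proof.
case=> BN HE [U [UHB pU _ p'H rad]] JK; have KJ := lie_rank2_sym JK.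
have [X [nHN rX genN genG]] := BN_pair_reflections BN.
have [s Xs XJ] := rank2_panel nHN rX genN genG JK.
have [t Xt XK] := rank2_panel nHN rX genN genG KJ.
have nUB : U <| B by have [] := sdprod_context UHB.
have over (Y : {group gT}) : B \subset Y ->
    [\/ Y :=: B, Y :=: J, Y :=: K | Y :=: [set: gT]].
  move=> sBY; have [[YB|YJ|YG]|sYK] := rank2_overgroup nHN rX genN genG JK Xs XJ sBY.
  - exact: Or41.
  - exact: Or42.
  - exact: Or44.
  have [YB|[YK _]] := panel_overgroup nHN rX genN genG KJ Xt XK sBY sYK.
    exact: Or41.
  exact: Or43.
have notN x : x \in X -> x \notin 'N(U).
  exact: (reflection_norm_unipotent nHN rX UHB).
have normU : 'N(U) = B.
  have [//|YJ|YK|YG] := over 'N(U)%G (normal_norm nUB).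
  - by have := notN s Xs; rewrite YJ (panel_reflection XJ).
  - by have := notN t Xt; rewrite YK (panel_reflection XK).
  - by have := notN s Xs; rewrite YG inE.
have sUB := normal_sub nUB.
exists U; split=> //.
- exists (U :&: U :^ s)%G; split.
  + exact: pgroupS (subsetIl _ _) pU.
  + exact: (panel_radical_neq1 nHN rX genN JK Xs XJ Xt XK UHB pU).
  + exact: (panel_radical nHN rX genN JK Xs XJ UHB).
- exists (U :&: U :^ t)%G; split.
  + exact: pgroupS (subsetIl _ _) pU.
  + exact: (panel_radical_neq1 nHN rX genN KJ Xt XK Xs XJ UHB pU).
  + exact: (panel_radical nHN rX genN KJ Xt XK UHB).
(* Normalizers grow in p-groups, so a larger [S] would contain a p-element normalizing [U] but
   outside it. Such an element is in ['N(U) = B], whose p-elements all lie in [U]. *)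
- have [S sylS sUS] := Sylow_superset (subsetT U) pU.
  suff -> : U = S by [].
  apply/val_inj/eqP => /=; apply/idPn => neq.
  have ltUS : U \proper S by rewrite properEneq neq.
  have pS := pHall_pgroup sylS.
  have /properP[_ [x /setIP[Sx]]] := nilpotent_proper_norm (pgroup_nil pS) ltUS.
  rewrite normU => Bx; apply/negP/negPn.
  have : <[x]> \subset U.
    apply: (p_subgroup_Borel UHB pU p'H); last by rewrite cycle_subG.
    exact: mem_p_elt pS Sx.
  by rewrite cycle_subG.
- exact: (unipotent_neq1 nHN rX Xs UHB).
- by move=> P C g x; apply: (fixed_chamber_ind nHN rX genN genG JK).
- move=> P E g.
  exact: (fixed_chamber_extremal nHN rX genN genG JK Xs XJ Xt XK HE).
Qed.

End Parabolics.

From mathcomp Require Import all_classical all_reals all_analysis.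
From mathcomp Require Import ring lra.
Require Import Defs.
Import Order.TTheory GRing.Theory Num.Theory numFieldNormedType.Exports.

(** * Geometric realizations *)

Section Continuity.
Local Open Scope classical_set_scope.
Local Open Scope ring_scope.
Variable R : realType.

Lemma within_continuous_comp_sub (S T W : topologicalType) (A : set S) (B : set T)
    (f : S -> T) (g : T -> W) :
  {within A, continuous f} -> {within B, continuous g} ->
  (forall x, A x -> B (f x)) -> {within A, continuous (g \o f)}.
Proof.
move=> /subspace_continuousP cf /subspace_continuousP cg fAB.
apply/subspace_continuousP => x Ax; apply: cvg_trans (cg _ (fAB x Ax)).
move=> U /= gU; rewrite /within /= nbhs_simpl in gU *.
have := cf x Ax _ gU; rewrite /= !nbhs_simpl /within /= => h.
by apply: filterS h => y fy Ay; apply: fy => //; apply: fAB.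
Qed.

Lemma ptws_within_continuous (T : topologicalType) (A : set T) (V : finType)
    (f : T -> {ptws V -> R}) :
  (forall v, {within A, continuous (fun x => f x v)}) -> {within A, continuous f}.
Proof.
move=> cf; apply/subspace_continuousP => x Ax.
have FF : Filter (within A (nbhs x)) by exact: within_filter.
apply/cvg_sup => v; rewrite cvg_image; last first.
  by rewrite eqEsubset; split=> r // _; exists (cst r).
have /subspace_continuousP/(_ x Ax) := cf v.
move=> + W /= => h /h Q; exists (@^~ v @^-1` W) => //.
by rewrite eqEsubset; split => [j [? + <-//]|j Wj]; exists (fun=> j).
Qed.

Lemma ptws_coord_continuous (V : finType) (v : V) :
  continuous (fun x : {ptws V -> R} => x v).
Proof. exact: (@proj_continuous V (fun=> R) v). Qed.

End Continuity.

Section Realization.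
Local Open Scope ring_scope.
Variable R : realType.
Variables (gT : finGroupType) (V : finType) (to : {action gT &-> V}).
Implicit Types (D : {set {set V}}) (x y : {ptws V -> R}) (A : {set gT}).

Definition supp x : {set V} := [set v | x v != 0]%SET.

Lemma mem_setact_inv (S : {set V}) a v :
  (v \in (to^*)%act S a) = (to v (a^-1)%g \in S).
Proof.
apply/imsetP/idP => [[w Sw ->]|Sv]; first by rewrite actK.
by exists (to v (a^-1)%g); rewrite ?actKV.
Qed.

Definition vertex_point (v : V) : {ptws V -> R} := fun w => (w == v)%:R.

Lemma supp_vertex_point v : supp (vertex_point v) = [set v]%SET.
Proof. by apply/setP => w; rewrite !inE pnatr_eq0 eqb0 negbK. Qed.

Lemma realization_vertex D v : [set v]%SET \in D -> realization R D (vertex_point v).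
Proof.
move=> Dv; split; first by move=> w; rewrite ler0n.
  by rewrite (bigD1 v) //= big1 ?addr0 /vertex_point ?eqxx // => w /negbTE->.
by rewrite -/(supp _) supp_vertex_point.
Qed.

Lemma ract_vertex v a : to v a = v -> ract to (vertex_point v) a = vertex_point v.
Proof.
move=> va; apply/funext=> w; rewrite /ract /vertex_point -(inj_eq (act_inj to a)).
by rewrite actKV va.
Qed.

(** An element fixing [x] stabilizes its support setwise; the stabilizer condition of a G-complex
    turns this into fixing it pointwise. *)
Lemma realization_fixed D x a : gcomplex to D -> realization R D x ->
  ract to x a = x -> supp x \subset ('Fix_to[a])%g.
Proof.
case=> _ _ _ stab [_ _ xD] xa; apply/fintype.subsetP => v xv.
have : a \in ('N(supp x | to))%g.
  by apply/astabsP => w; rewrite !inE -{1}xa /ract actK.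
move=> /(fintype.subsetP (stab _ xD)) /astabP/(_ v xv) va; exact/afix1P.
Qed.

Lemma ract_fixed x a : supp x \subset ('Fix_to[a])%g -> ract to x a = x.
Proof.
move=> fx; apply/funext => v; rewrite /ract.
have [xv|] := boolP (v \in supp x).
  have /afix1P va := fintype.subsetP fx v xv; by rewrite -{1}va actK.
have [xv|] := boolP (to v (a^-1)%g \in supp x).
  by have /afix1P := fintype.subsetP fx _ xv; rewrite actKV => <-.
by rewrite !inE !negbK => /eqP-> /eqP->.
Qed.

(** This describes fixed complexes by the action on points alone, so that they can be transported
    along maps that are not simplicial. *)
Lemma realization_fixed_complex D x (A : {group gT}) : gcomplex to D ->
  realization R (fixed_complex to D A) x <->
  realization R D x /\ forall a, a \in A -> ract to x a = x.
Proof.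
move=> gD; split=> [[x0 x1]|[xD xA]].
  rewrite inE => /andP[xD xA]; split=> // a Aa; apply: ract_fixed.
  by apply: fintype.subset_trans xA _; apply: afixS; rewrite finset.sub1set.
have [x0 x1 sD] := xD; split=> //; rewrite inE sD /=.
apply/fintype.subsetP => v xv; apply/afixP => a Aa.
have := realization_fixed gD xD (xA a Aa) => /fintype.subsetP/(_ v xv)/afix1P; exact.
Qed.

Lemma realization_convex D x y (c : R) : 0 <= c <= 1 ->
  realization R D x -> realization R D y ->
  (forall s, s != finset.set0 -> s \subset (supp x :|: supp y)%SET -> s \in D) ->
  realization R D (fun v => x v + c * (y v - x v)).
Proof.
move=> /andP[c0 c1] [x0 x1 sx] [y0 y1 sy] DS.
have xyE v : x v + c * (y v - x v) = (1 - c) * x v + c * y v by ring.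
have c1' : 0 <= 1 - c by rewrite subr_ge0.
split.
- by move=> v; rewrite xyE addr_ge0 ?mulr_ge0.
- by rewrite big_split /= -mulr_sumr sumrB x1 y1 subrr mulr0 addr0.
apply: DS; last first.
  apply/fintype.subsetP => v; rewrite !inE; apply: contraR; rewrite negb_or !negbK.
  by move=> /andP[/eqP-> /eqP->]; rewrite subrr mulr0 addr0.
apply/negP => /eqP/setP xy0.
have : \sum_v (x v + c * (y v - x v)) = 0.
  by rewrite big1 // => v _; have := xy0 v; rewrite !inE => /negbFE/eqP.
rewrite big_split /= -mulr_sumr sumrB x1 y1 subrr mulr0 addr0.
by move/eqP; rewrite oner_eq0.
Qed.

End Realization.

(** * Equivariant contractibility *)

Section WithinReal.
Local Open Scope ring_scope.
Local Open Scope classical_set_scope.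
Variables (R : realType) (S : topologicalType) (A : set S).
Implicit Types f g : S -> R.

Lemma within_continuousD f g : {within A, continuous f} ->
  {within A, continuous g} -> {within A, continuous (fun x => f x + g x)}.
Proof. by move=> cf cg x; apply: cvgD (cf x) (cg x). Qed.

Lemma within_continuousB f g : {within A, continuous f} ->
  {within A, continuous g} -> {within A, continuous (fun x => f x - g x)}.
Proof. by move=> cf cg x; apply: cvgB (cf x) (cg x). Qed.

Lemma within_continuousM f g : {within A, continuous f} ->
  {within A, continuous g} -> {within A, continuous (fun x => f x * g x)}.
Proof. by move=> cf cg x; apply: cvgM (cf x) (cg x). Qed.

Lemma within_continuous_max f g : {within A, continuous f} ->
  {within A, continuous g} -> {within A, continuous (fun x => Num.max (f x) (g x))}.
Proof. by move=> cf cg x; apply: (continuous_max (cf x) (cg x)). Qed.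

Lemma within_continuous_min f g : {within A, continuous f} ->
  {within A, continuous g} -> {within A, continuous (fun x => Num.min (f x) (g x))}.
Proof. by move=> cf cg x; apply: (continuous_min (cf x) (cg x)). Qed.

Lemma within_continuous_sum (I : Type) (r : seq I) (P : pred I) (F : I -> S -> R) :
  (forall i, P i -> {within A, continuous (F i)}) ->
  {within A, continuous (fun x => \sum_(i <- r | P i) F i x)}.
Proof.
move=> cF; exact: (@continuous_big R I +%R 0 P (@add_continuous R^o) (subspace A) r
  F cF).
Qed.

Lemma within_continuous_coord (V : finType) (f : S -> {ptws V -> R}) v :
  {within A, continuous f} -> {within A, continuous (fun x => f x v)}.
Proof.
by move=> cf x; apply: (cvg_comp _ _ (cf x) (@ptws_coord_continuous R V v (f x))).
Qed.

End WithinReal.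

Lemma within_continuous_pair (S T1 T2 : topologicalType) (A : set S)
    (f : S -> T1) (g : S -> T2) :
  {within A, continuous f}%classic -> {within A, continuous g}%classic ->
  {within A, continuous (fun x => (f x, g x))}%classic.
Proof. by move=> cf cg x; apply: cvg_pair (cf x) (cg x). Qed.

Section Contractible.
Local Open Scope ring_scope.
Variable R : realType.
Variables (gT : finGroupType) (V : finType) (to : {action gT &-> V}).
Implicit Types (D : {set {set V}}) (x y : {ptws V -> R}) (A : {set gT}).

Lemma within_cst (S T : topologicalType) (A : set S) (c : T) :
  {within A, continuous (fun=> c)}%classic.
Proof. by apply: continuous_subspaceT => ?; apply: cvg_cst. Qed.

Lemma within_id (S : topologicalType) (A : set S) : {within A, continuous id}%classic.
Proof. by apply: continuous_subspaceT => ?; apply: cvg_id. Qed.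

Lemma within_snd (S T : topologicalType) (A : set (S * T)) :
  {within A, continuous snd}%classic.
Proof. by apply: continuous_subspaceT => ?; apply: cvg_snd. Qed.

Lemma within_fst (S T : topologicalType) (A : set (S * T)) :
  {within A, continuous fst}%classic.
Proof. by apply: continuous_subspaceT => ?; apply: cvg_fst. Qed.

Lemma gmap_cst A D y : realization R D y -> (forall a, a \in A -> ract to y a = y) ->
  forall (V' : finType) (to' : {action gT &-> V'}) (D' : {set {set V'}}),
  gmap A to' D' to D (fun=> y).
Proof.
by move=> Dy fy V' to' D'; split=> [||x a _ /fy->] //; apply: within_cst.
Qed.

Lemma ghomotopic_refl (V1 V2 : finType) (to1 : {action gT &-> V1})
    (to2 : {action gT &-> V2}) A (D1 : {set {set V1}}) (D2 : {set {set V2}})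
    (f g : {ptws V1 -> R} -> {ptws V2 -> R}) :
  gmap A to1 D1 to2 D2 f -> (forall x : {ptws V1 -> R}, realization R D1 x ->
    f x = g x) ->
  ghomotopic A to1 D1 to2 D2 f g.
Proof.
move=> [cf fD fA] fg; exists (f \o snd); split=> //.
apply: (within_continuous_comp_sub (@within_snd _ _ _) cf).
by move=> -[t x] [].
Qed.

Lemma point_realizationE (z : {ptws unit -> R}) :
  realization R point_complex z -> z = fun=> 1.
Proof.
move=> [_ z1 _]; apply/funext=> -[].
by move: z1; rewrite (bigD1 tt) //= big1 ?addr0 // => -[].
Qed.

Lemma point_realization : realization R point_complex (fun=> 1).
Proof.
split=> [v||]; first exact: ler01.
  by rewrite (bigD1 tt) //= big1 ?addr0 // => -[].
rewrite inE; apply/eqP/setP => -[]; rewrite !inE oner_eq0.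
by rewrite eqxx.
Qed.

(** The realization of the point complex has one element, so one of the two maps carries no
    information and the other amounts to a fixed point [y], the centre of the contraction. *)
Lemma gcontractibleP A D : gcontractible R A to D <->
  exists y, [/\ realization R D y, forall a, a \in A -> ract to y a = y
                & ghomotopic A to D to D (fun=> y) id].
Proof.
split=> [[f [g [[cf fD fA] [cg gD gA] hgf hfg]]]|[y [Dy fy hy]]].
  have fE x : realization R D x -> f x = fun=> 1.
    by move=> /fD/point_realizationE.
  exists (g (fun=> 1)); split.
  - exact/gD/point_realization.
  - by move=> a Aa; rewrite -gA //; exact: point_realization.
  - have [h [ch hm h0 h1]] := hgf; exists h; split=> // x Dx.
    by rewrite h0 //= fE.
exists (fun=> (fun=> 1)), (fun=> y); split=> //.
- by split=> // *; [apply: within_cst|apply: point_realization].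
- exact: gmap_cst.
- apply: ghomotopic_refl.
    by split=> // *; [apply: within_cst|apply: point_realization].
  by move=> x /point_realizationE.
Qed.

Lemma gcontractible_vertex A v :
  (forall a, a \in A -> to v a = v) -> gcontractible R A to [set [set v]]%SET.
Proof.
move=> fv; apply/gcontractibleP; exists (vertex_point R v).
have Dv : realization R [set [set v]]%SET (vertex_point R v).
  by apply: realization_vertex; rewrite inE.
split=> //; first by move=> a Aa; apply/ract_vertex/fv.
apply: ghomotopic_refl; first by apply: gmap_cst => // a Aa; apply/ract_vertex/fv.
move=> x [x0 x1]; rewrite inE => /eqP/setP xv.
have xw w : w != v -> x w = 0.
  by move=> wv; have := xv w; rewrite !inE (negbTE wv) => /negbFE/eqP.
apply/funext=> w; rewrite /vertex_point; have [->|/xw//] := eqVneq w v.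
by move: x1; rewrite (bigD1 v) //= big1 ?addr0 // => u /xw.
Qed.

(** The map of realizations induced by the vertex map [r]. *)
Definition push (r : V -> V) x : {ptws V -> R} := fun w => \sum_(v | r v == w) x v.

Lemma supp_push r x : (forall v, 0 <= x v) -> supp (push r x) = (r @: supp x)%SET.
Proof.
move=> x0; apply/setP=> w; rewrite inE /push psumr_neq0 //.
apply/hasP/imsetP => [[v _ /andP[/eqP rv xv]]|[v xv ->]].
  by exists v; rewrite // inE lt0r_neq0.
exists v; rewrite ?mem_index_enum // eqxx lt0r x0 andbT.
by move: xv; rewrite inE.
Qed.

Lemma sum_push r x : \sum_w push r x w = \sum_v x v.
Proof.
rewrite /push (exchange_big_dep xpredT) //=; apply: eq_bigr => v _.
by rewrite (bigD1 (r v)) //= big1 ?addr0 // => w /andP[/eqP-> /eqP].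
Qed.

Lemma push_continuous r : continuous (push r).
Proof.
apply/continuous_subspace_setT/ptws_within_continuous => w.
apply: within_continuous_sum => v _; apply: continuous_subspaceT.
exact: ptws_coord_continuous.
Qed.

Lemma ract_push r x a : (forall v, v \in supp x -> r (to v a) = to (r v) a) ->
  push r (ract to x a) = ract to (push r x) a.
Proof.
move=> ra; apply/funext => w; rewrite /push /ract.
rewrite (reindex_inj (act_inj to a)) /= [LHS]big_mkcond [RHS]big_mkcond.
apply: eq_bigr => v _; rewrite actK.
have [xv|] := boolP (v \in supp x); last first.
  by rewrite inE negbK => /eqP->; rewrite !if_same.
rewrite ra // -(inj_eq (act_inj to a^-1%g)) actK.
by [].
Qed.

(* Both halves of the homotopy are glued by adding displacements, which avoids
   a pasting argument. *)
Lemma gcontractible_collapse A D D' (r : V -> V) :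
  (forall s t : {set V}, s \in D -> t \subset s -> t != finset.set0 -> t \in D) ->
  D' \subset D ->
  (forall s, s \in D -> (r @: s)%SET \in D') ->
  (forall s, s \in D -> (s :|: r @: s)%SET \in D) ->
  (forall s v a, s \in D -> v \in s -> a \in A -> r (to v a) = to (r v) a) ->
  gcontractible R A to D' -> gcontractible R A to D.
Proof.
move=> closedD /fintype.subsetP sD'D rD' rD rA.
move=> /gcontractibleP[y [[y0 y1 yD'] fy [h [ch hm h0 h1]]]].
have sub x : realization R D' x -> realization R D x.
  by move=> [? ? /sD'D].
have pushD' x : realization R D x -> realization R D' (push r x).
  move=> [x0 x1 xD]; split; last by rewrite -/(supp _) supp_push // rD'.
    by move=> v; apply: sumr_ge0.
  by rewrite sum_push.
apply/gcontractibleP; exists y; split=> //; first exact: sub.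
(* Up to time 1/2 the first summand runs from [y] to [push r x] and the second vanishes; afterwards
   the first rests at [push r x] and the second slides it linearly to [x]. *)
pose H (tx : R * {ptws V -> R}) : {ptws V -> R} := fun w =>
  h (Num.min (2 * tx.1) 1, push r tx.2) w
  + Num.max (2 * tx.1 - 1) 0 * (tx.2 w - push r tx.2 w).
have cH : {within (`[0%R, 1%R] `*` realization R D), continuous H}%classic.
  apply: ptws_within_continuous => w; apply: within_continuousD.
    pose c (tx : R * {ptws V -> R}) := (Num.min (2 * tx.1) 1, push r tx.2).
    apply: (within_continuous_coord (f := h \o c)).
    apply: (within_continuous_comp_sub _ ch).
      apply: within_continuous_pair.
        apply: within_continuous_min; last exact: within_cst.
        by apply: within_continuousM; [exact: within_cst|exact: within_fst].
      have cp : {within setT, continuous (push r)}%classic.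
        exact/continuous_subspaceT/push_continuous.
      exact: (within_continuous_comp_sub (@within_snd _ _ _) cp).
    move=> [t x] [/=]; rewrite in_itv /= => /andP[t0 t1] Dx.
    split; last exact: pushD'.
    by rewrite /= in_itv /= le_min ge_min lexx orbT ler01 mulr_ge0.
  apply: within_continuousM.
    apply: within_continuous_max; last exact: within_cst.
    apply: within_continuousB; last exact: within_cst.
    by apply: within_continuousM; [exact: within_cst|exact: within_fst].
  apply: within_continuousB; first exact/within_continuous_coord/within_snd.
  apply: (@within_continuous_coord _ _ _ _ (push r \o snd)).
  have cp : {within setT, continuous (push r)}%classic.
    exact/continuous_subspaceT/push_continuous.
  exact: (within_continuous_comp_sub (@within_snd _ _ _) cp).
exists H; split => //.
- move=> t t01; split.
  + apply: (within_continuous_comp_sub _ cH).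
      by apply: within_continuous_pair; [exact: within_cst|exact: within_id].
    by move=> x Dx; split=> //=; rewrite in_itv.
  + move=> x Dx; rewrite /H /=; have [x0 x1 xD] := Dx; have /andP[t0 t1] := t01.
    have [le|gt] := leP (2 * t) 1.
      have {}le0 : 2 * t - 1 <= 0 by lra.
      have t01' : 0 <= 2 * t <= 1 by apply/andP; split; lra.
      have [_ hD _] := hm _ t01'.
      rewrite (_ : (fun w => _) = h (2 * t, push r x)); first exact/sub/hD/pushD'.
      by apply/funext => w; rewrite (max_r le0) mul0r addr0.
    have gt0 : 0 <= 2 * t - 1 by lra.
    rewrite (_ : (fun w => _) = fun w =>
      push r x w + (2 * t - 1) * (x w - push r x w)).
      apply: realization_convex => //.
      * by apply/andP; split; lra.
      * exact/sub/pushD'.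
      * move=> s s0 ss; apply: closedD (rD _ xD) _ s0.
        by rewrite finset.setUC -/(supp _) -supp_push.
    by apply/funext => w; rewrite (max_l gt0) h1 //; apply: pushD'.
  + move=> x a Dx Aa; apply/funext => w; rewrite /H /=.
    have -> : push r (ract to x a) = ract to (push r x) a.
      by apply: ract_push => v xv; case: Dx => _ _ xD; apply: rA xD _ Aa.
    have m01 : 0 <= Num.min (2 * t) 1 <= 1.
      by rewrite le_min ge_min lexx orbT ler01 mulr_ge0 //; case/andP: t01.
    have [_ _ hA] := hm _ m01.
    by rewrite hA //; apply: pushD'.
- move=> x Dx; apply/funext => w; rewrite /H /= mulr0 sub0r.
  by rewrite min_l ?ler01 // max_r ?lerN10 // mul0r addr0 h0 //; apply: pushD'.
- move=> x Dx; apply/funext => w; rewrite /H /= mulr1.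
  rewrite min_r ?max_l; try lra.
  by rewrite h1; [rewrite /id; lra|apply: pushD'].
Qed.

End Contractible.

(** * Fixed vertices and paths obtained from a contraction *)

Section Connected.
Local Open Scope ring_scope.
Variable R : realType.

Lemma within_continuous_bool (f : R -> R) :
  {within `[0%R, 1%R], continuous f}%classic ->
  (forall t, 0 <= t <= 1 -> f t = 0 \/ f t = 1) -> f 0 = f 1.
Proof.
move=> cf f01; have h (t : R) : t = 0 \/ t = 1 -> 0 <= t <= 1.
  by case=> ->; rewrite lexx ler01.
have f2 c : c \in `[0, 1]%R -> f c <> 2^-1.
  by rewrite in_itv /= => /f01 [] ->; lra.
have ivt v : Num.min (f 0) (f 1) <= v <= Num.max (f 0) (f 1) ->
  exists2 c, c \in `[0, 1]%R & f c = v.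
  exact: IVT.
have [f0|f0] := f01 0 (h _ (or_introl erefl));
  have [f1|f1] := f01 1 (h _ (or_intror erefl)); rewrite ?f0 ?f1 //.
  have [|c /f2//] := ivt 2^-1; rewrite f0 f1 min_l ?ler01 // max_r ?ler01 //.
  by apply/andP; split; lra.
have [|c /f2//] := ivt 2^-1; rewrite f0 f1 min_r ?ler01 // max_l ?ler01 //.
by apply/andP; split; lra.
Qed.

Variables (gT : finGroupType) (V : finType) (to : {action gT &-> V}).
Implicit Types (D : {set {set V}}) (x y : {ptws V -> R}).

Lemma realization_supp_neq0 D x : realization R D x -> exists v, v \in supp x.
Proof.
move=> [_ x1 _]; apply/existsP; apply: contraT; rewrite negb_exists => /forallP x0.
have : \sum_v x v = 0.
  by rewrite big1 // => v _; have := x0 v; rewrite inE negbK => /eqP.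
by rewrite x1 => /eqP; rewrite oner_eq0.
Qed.

Lemma realization_fixed_group D x (A : {group gT}) : gcomplex to D ->
  realization R D x ->
  (forall a, a \in A -> ract to x a = x) -> supp x \subset ('Fix_to(A))%g.
Proof.
move=> gD xD /(conj xD)/(realization_fixed_complex _ _ gD)[_ _].
by rewrite inE => /andP[].
Qed.

Lemma gcontractible_fixed_vertex D (P A : {group gT}) : gcomplex to D ->
  gcontractible R A to (fixed_complex to D P) ->
  exists v, [/\ [set v]%SET \in D, v \in ('Fix_to(P))%g & v \in ('Fix_to(A))%g].
Proof.
move=> gD /gcontractibleP[y [Dy fy _]].
have [v yv] := realization_supp_neq0 Dy.
have [_ _] := Dy; rewrite inE => /andP[yD yP].
have yD' : realization R D y by case: Dy => y0 y1 _; split.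
exists v; split; last 2 first.
- exact: (fintype.subsetP yP).
- exact: (fintype.subsetP (realization_fixed_group gD yD' fy)).
have [_ clD _ _] := gD; apply: clD yD _ _; first by rewrite finset.sub1set.
by apply/set0Pn; exists v; rewrite inE.
Qed.

(** [phi] measures the mass that a point has on the component of [v]. The support of an [A]-fixed
    point is a simplex of [A]-fixed vertices and lies in one component, so [phi] is 0 or 1 there. It
    is constant along the track from the centre [y] to any [A]-fixed vertex, hence equal at [v] and
    [w]. *)
Lemma gcontractible_fixed_connected D (P A : {group gT}) v w : gcomplex to D ->
  gcontractible R A to (fixed_complex to D P) ->
  [set v]%SET \in fixed_complex to D P -> v \in ('Fix_to(A))%g ->
  [set w]%SET \in fixed_complex to D P -> w \in ('Fix_to(A))%g ->
  connect (fun u u' => [&& [set u; u']%SET \in D, u \in ('Fix_to(A))%g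
                         & u' \in ('Fix_to(A))%g]) v w.
Proof.
move=> gD /gcontractibleP[y [Dy fy [h [ch hm h0 h1]]]] Dv Av Dw Aw.
set e := (X in connect X).
pose phi x := \sum_(u | connect e v u) x u.
have phi01 x : realization R (fixed_complex to D P) x ->
    (forall a, a \in A -> ract to x a = x) -> phi x = 0 \/ phi x = 1.
  move=> [x0 x1]; rewrite inE => /andP[xD xP] xA.
  have Dx : realization R D x by split.
  have /fintype.subsetP xfix := realization_fixed_group gD Dx xA.
  have [/existsP[u /andP[xu cu]]|none] :=
    boolP [exists u, (u \in supp x) && connect e v u]; last first.
    left; apply: big1 => u cu; apply/eqP; apply: contraNT none => xu.
    by apply/existsP; exists u; rewrite cu andbT inE.
  right; rewrite -x1 /phi [RHS](bigID (connect e v)) /= [X in _ + X]big1 ?addr0 //.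
  move=> u' cu'; apply/eqP; apply: contraNT cu' => xu'.
  have xu2 : u' \in supp x by rewrite inE.
  apply: connect_trans cu _; apply: connect1; rewrite /e !xfix ?andbT //.
  have [_ clD _ _] := gD; apply: clD xD _ _.
    by apply/fintype.subsetP => z; rewrite !inE => /orP[]/eqP->;
      [move: xu|move: xu2]; rewrite inE.
  by apply/set0Pn; exists u; rewrite !inE eqxx.
have path z : [set z]%SET \in fixed_complex to D P -> z \in ('Fix_to(A))%g ->
    phi y = (connect e v z)%:R.
  move=> Dz Az; have rz := realization_vertex R Dz.
  have -> : (connect e v z)%:R = phi (vertex_point R z).
    rewrite /phi /vertex_point; have [cz|ncz] := boolP (connect e v z).
      by rewrite (bigD1 z) //= eqxx big1 ?addr0 // => u /andP[_ /negbTE->].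
    rewrite big1 // => u cu; case: eqP => // uz.
    by move: ncz; rewrite -uz cu.
  rewrite -(h0 _ rz) -[X in _ = phi X](h1 _ rz).
  apply: (@within_continuous_bool (fun t => phi (h (t, vertex_point R z)))).
    apply: within_continuous_sum => u _.
    apply: (within_continuous_coord (f := h \o (fun t => (t, vertex_point R z)))).
    apply: (within_continuous_comp_sub _ ch).
      by apply: within_continuous_pair; [exact: within_id|exact: within_cst].
    by move=> t t01; split.
  move=> t /hm [_ hD hA]; apply: phi01; first exact: hD.
  move=> a Aa; rewrite -hA // ract_vertex //.
  by move: Az => /afixP/(_ a Aa).
have := path v Dv Av; rewrite connect0 (path w Dw Aw).
by case: (connect e v w) => // /eqP; rewrite eq_sym oner_eq0.
Qed.

End Connected.

(** * Trees *)

Section Tree.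
Variable R : realType.
Variables (gT : finGroupType) (V : finType) (to : {action gT &-> V}).
Variables (D : {set {set V}}) (A : {group gT}) (col : V -> bool).
Hypothesis D0 : finset.set0 \notin D.
Hypothesis clD : forall s t : {set V},
  s \in D -> t \subset s -> t != finset.set0 -> t \in D.
Hypothesis actD : forall s a, s \in D -> a \in A -> (to^*)%act s a \in D.
Hypothesis col_act : forall v a, a \in A -> col (to v a) = col v.
Hypothesis col_inj : forall (s : {set V}) u v,
  s \in D -> u \in s -> v \in s -> col u = col v -> u = v.
Implicit Types (T S : {set V}).

Definition subcomplex_on T : {set {set V}} := [set s in D | s \subset T]%SET.
Definition nbrs T v : {set V} := [set w in T | (w != v) &&
  ([set v; w]%SET \in D)]%SET.

Lemma actD_iff s a : a \in A -> ((to^*)%act s a \in D) = (s \in D).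
Proof.
move=> Aa; apply/idP/idP => [sD|/actD]; last exact.
by have := actD sD (groupVr Aa); rewrite actK.
Qed.

Lemma setact2 u v a : (to^*)%act [set u; v]%SET a = [set to u a; to v a]%SET.
Proof.
by apply/setP=> w; rewrite mem_setact_inv !inE !(canF_eq (actKV to a)).
Qed.

Lemma nbrs_act T v a : (forall v a, v \in T -> a \in A -> to v a \in T) -> a \in A ->
  nbrs T (to v a) = (to^*)%act (nbrs T v) a.
Proof.
move=> TA Aa; have TA' w : (w \in T) = (to w (a^-1)%g \in T).
  apply/idP/idP => [/TA|/TA h]; first by apply; rewrite groupV.
  by rewrite -[w](actKV to a) h.
apply/setP=> w; rewrite mem_setact_inv !inE -TA' (canF_eq (actKV to a)).
suff -> : ([set to v a; w] \in D)%SET = ([set v; to w a^-1%g] \in D)%SET by [].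
by rewrite -[RHS](actD_iff _ Aa) setact2 actKV.
Qed.

Definition connected_on T := forall S, S \subset T -> S != finset.set0 -> S != T ->
  exists u w, [/\ u \in S, w \in T, w \notin S & [set u; w]%SET \in D].

(** Asking for a leaf in every non-empty subset, rather than in [T] alone, makes the condition pass
    to the pruned vertex set. *)
Definition acyclic_on T := forall S, S \subset T -> S != finset.set0 ->
  exists2 v, v \in S & #|nbrs S v| <= 1.

(* Pruning the leaves of a single colour at a time keeps two adjacent leaves
   from being removed together. *)
Lemma tree_contractible T : T != finset.set0 ->
  (forall v, v \in T -> [set v]%SET \in D) ->
  (forall v a, v \in T -> a \in A -> to v a \in T) ->
  connected_on T -> acyclic_on T -> gcontractible R A to (subcomplex_on T).
Proof.
have [n] := ubnP #|T|; elim: n T => // n IH T ltT T0 TD TA cT aT.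
have clT (s t : {set V}) : s \in subcomplex_on T -> t \subset s -> t != finset.set0 ->
    t \in subcomplex_on T.
  rewrite !inE => /andP[sD sT] ts t0; rewrite (clD sD ts t0) /=.
  exact: fintype.subset_trans ts sT.
have [v0 Tv0 lv0] := aT T (fintype.subxx T) T0.
have [T1|T1] := eqVneq #|T| 1%N.
  have /eqP/cards1P[v TE] := T1; have Tv : v \in T by rewrite TE inE.
  have -> : subcomplex_on T = [set [set v]]%SET.
    apply/setP=> s; rewrite !inE TE finset.subset1; case: eqVneq => [->|_] /=.
      by rewrite TD.
    by apply/negP => /andP[+ /eqP s0]; rewrite s0 (negbTE D0).
  by apply: gcontractible_vertex => a Aa; have := TA v a Tv Aa;
    rewrite TE inE => /eqP.
have nbrs0 v : v \in T -> nbrs T v != finset.set0.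
  move=> Tv; have [||| u [w [+ Tw]]] := cT [set v]%SET.
  - by rewrite finset.sub1set.
  - by apply/set0Pn; exists v; rewrite inE.
  - by apply: contra T1 => /eqP <-; rewrite cards1.
  rewrite !inE => /eqP-> wv vw; apply/set0Pn; exists w.
  by rewrite inE Tw wv.
(* [c] is the colour of some leaf, so [L] is not empty. The default in [r] is never taken, because
   every vertex of [T] has a neighbour by [nbrs0]. *)
pose c := col v0; pose L := [set v in T | (col v == c) && (#|nbrs T v| <= 1)]%SET.
pose r v := if v \in L then odflt v [pick w in nbrs T v] else v.
have rL v : v \in L -> nbrs T v = [set r v]%SET.
  move=> Lv; rewrite /r Lv; have := Lv; rewrite inE => /and3P[Tv _ le1].
  have /eqP/cards1P[w wE] : #|nbrs T v| = 1%N.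
    by apply/eqP; rewrite eqn_leq le1 card_gt0 nbrs0.
  by rewrite wE; case: pickP => [u|/(_ w)]; rewrite !inE ?eqxx // => /eqP->.
have rLn v : v \in L -> [/\ r v \in T, r v != v,
  [set v; r v]%SET \in D & r v \notin L].
  move=> Lv; have : r v \in nbrs T v by rewrite rL // inE.
  rewrite inE => /and3P[Trv rv vr]; split=> //; apply/negP.
  have := Lv; rewrite !inE => /and3P[_ /eqP cv _] /and3P[_ /eqP crv _].
  by case/eqP: rv; apply: (col_inj vr); rewrite ?inE ?eqxx ?orbT // cv crv.
have rnL v : v \notin L -> r v = v by rewrite /r => /negbTE->.
have LA v a : v \in T -> a \in A -> (to v a \in L) = (v \in L).
  move=> Tv Aa; rewrite !inE Tv TA // col_act // nbrs_act //.
  by rewrite card_setact.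
have rA v a : v \in T -> a \in A -> r (to v a) = to (r v) a.
  move=> Tv Aa; have [Lv|nLv] := boolP (v \in L); last by rewrite !rnL // LA.
  have /setP/(_ (r (to v a))) := nbrs_act v TA Aa.
  rewrite rL ?LA // inE eqxx rL // mem_setact_inv inE => /esym/eqP <-.
  by rewrite actKV.
pose T' := (T :\: L)%SET.
have L0 : v0 \in L by rewrite inE Tv0 eqxx.
(* A simplex with a vertex [v] in [L] has no other vertex than possibly the only neighbour of [v],
   so [r] shrinks it to [r v]. *)
have simp (s : {set V}) v : s \in subcomplex_on T -> v \in s -> v \in L ->
    (r @: s = [set r v])%SET /\ (s :|: [set r v] = [set v; r v])%SET.
  rewrite inE => /andP[sD /fintype.subsetP sT] sv Lv.
  have sE u : u \in s -> u = v \/ u = r v.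
    move=> su; have [->|uv] := eqVneq u v; [by left|right].
    have : u \in nbrs T v; last by rewrite rL // inE => /eqP.
    rewrite inE sT // uv; apply: clD sD _ _.
      by apply/fintype.subsetP => w; rewrite !inE => /orP[]/eqP->.
    by apply/set0Pn; exists v; rewrite !inE eqxx.
  have [_ _ _ nLr] := rLn v Lv; split; apply/setP=> u; rewrite !inE.
    apply/imsetP/eqP => [[w /sE[->|->] ->]|->]; rewrite ?(rnL (r v)) //.
    by exists v.
  apply/orP/orP => -[]; [move=> /sE[]->|move=> ->|move=> /eqP->|move=> ->];
    rewrite ?eqxx ?sv; auto.
have sub' S : S \subset T' -> S \subset T.
  by move=> h; apply: fintype.subset_trans h (finset.subsetDl _ _).
apply: (@gcontractible_collapse _ _ _ _ _ _ (subcomplex_on T') r) => //.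
- by apply/fintype.subsetP => s; rewrite !inE => /andP[-> /sub'].
- move=> s sT; have [/existsP[v /andP[sv Lv]]|none] :=
  boolP [exists v, (v \in s) && (v \in L)].
    have [-> _] := simp s v sT sv Lv; have [Tr _ vr nLr] := rLn v Lv.
    by rewrite inE (TD _ Tr) finset.sub1set inE nLr Tr.
  have nL v : v \in s -> v \notin L.
    by move=> sv; apply: contra none => Lv; apply/existsP; exists v; rewrite sv.
  have -> : (r @: s = s)%SET.
    apply/setP => v; apply/imsetP/idP => [[w sw ->]|sv]; first by rewrite rnL ?nL.
    by exists v; rewrite // rnL ?nL.
  have := sT; rewrite !inE => /andP[-> /fintype.subsetP sT2] /=.
  by apply/fintype.subsetP => v sv; rewrite inE nL // sT2.
- move=> s sT; have [/existsP[v /andP[sv Lv]]|none] :=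
  boolP [exists v, (v \in s) && (v \in L)].
    have [-> ->] := simp s v sT sv Lv; have [Tr _ vr nLr] := rLn v Lv.
    rewrite inE vr /=; apply/fintype.subsetP => u; rewrite !inE => /orP[]/eqP-> //.
    by have := Lv; rewrite inE => /andP[].
  have nL v : v \in s -> v \notin L.
    by move=> sv; apply: contra none => Lv; apply/existsP; exists v; rewrite sv.
  have -> : (r @: s = s)%SET.
    apply/setP => v; apply/imsetP/idP => [[w sw ->]|sv]; first by rewrite rnL ?nL.
    by exists v; rewrite // rnL ?nL.
  by rewrite finset.setUid.
- move=> s v a; rewrite inE => /andP[_ /fintype.subsetP sT] /sT; exact: rA.
have [Tr0 _ _ nLr0] := rLn v0 L0.
apply: IH.
- have : T' \proper T.
    apply/properP; split; first exact: finset.subsetDl.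
    by exists v0; rewrite // inE L0.
  by move=> /proper_card lt; apply: leq_trans lt _.
- by apply/set0Pn; exists (r v0); rewrite inE nLr0.
- by move=> v; rewrite inE => /andP[_ /TD].
- by move=> v a /finset.setDP[Tv nLv] Aa; apply/finset.setDP; rewrite LA // TA.
- move=> S ST' S0 SnT'.
  have ST := sub' S ST'.
  (* The leaves hanging on [S] are added, so that an edge of [T] leaving [S'] cannot involve a
     removed leaf and therefore leaves [S] inside [T']. *)
  pose S' := (S :|: [set v in L | r v \in S])%SET.
  have [||| x [y [xS' Ty yS' xy]]] := cT S'.
  + rewrite finset.subUset ST; apply/fintype.subsetP => v; rewrite inE => /andP[+ _].
    by rewrite inE => /andP[].
  + by have /set0Pn[u Su] := S0; apply/set0Pn; exists u; rewrite inE Su.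
  + have : S \proper T' by rewrite finset.properEneq SnT' ST'.
    move=> /properP[_ [u T'u nSu]]; apply/eqP => /setP/(_ u).
    have := T'u; rewrite inE => /andP[nLu Tu].
    by rewrite inE (negbTE nSu) inE (negbTE nLu) Tu.
  have xyn : x != y by apply: contraNneq yS' => <-.
  have nyS : y \notin S by apply: contra yS' => h; rewrite inE h.
  have nLx : x \notin L.
    apply/negP => Lx; have : y \in nbrs T x by rewrite inE Ty eq_sym xyn.
    rewrite rL // inE => /eqP yE; have := xS'; rewrite inE => /orP[Sx|].
      by have := fintype.subsetP ST' x Sx; rewrite inE Lx.
    by rewrite inE -yE (negbTE nyS) andbF.
  have Sx : x \in S by have := xS'; rewrite inE [X in _ || X]inE (negbTE nLx) orbF.
  have nLy : y \notin L.
    apply/negP => Ly; have : x \in nbrs T y.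
      by rewrite inE (fintype.subsetP ST) // xyn finset.setUC.
    rewrite rL // inE => /eqP xE.
    by have := yS'; rewrite inE (negbTE nyS) inE Ly -xE Sx.
  by exists x, y; rewrite Sx nyS xy inE nLy Ty.
- by move=> S /sub'; apply: aT.
Qed.

End Tree.

(** * The Tits building *)

Section Tits.
Variables (gT : finGroupType) (J K : {group gT}).
Local Notation D := (tits_building J K).
Local Notation to := (tits_act gT).
Local Open Scope group_scope.
Implicit Types (s : {set ({set gT} + {set gT})}) (v : ({set gT} + {set gT})%type).

Definition parabolic (e : bool) : {group gT} := if e then J else K.
Definition tits_vertex (e : bool) (x : gT) : ({set gT} + {set gT})%type :=
  if e then inl (J :* x) else inr (K :* x).
Definition tits_edge (x : gT) : {set {set gT} + {set gT}} :=
  [set tits_vertex true x; tits_vertex false x].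
Definition tits_type (v : ({set gT} + {set gT})%type) : bool :=
  if v is inl _ then true else false.

Lemma tits_typeE e x : tits_type (tits_vertex e x) = e.
Proof. by case: e. Qed.

Lemma tits_type_act v a : tits_type (to v a) = tits_type v.
Proof. by case: v. Qed.

Lemma tits_vertex_act e x a : to (tits_vertex e x) a = tits_vertex e (x * a).
Proof. by case: e; rewrite /= rcosetM. Qed.

Lemma tits_vertex_eq e x y :
  (tits_vertex e x == tits_vertex e y) = (x * y^-1 \in parabolic e).
Proof.
rewrite -mem_rcoset; case: e; rewrite /= /eq_op /=; apply/eqP/rcoset_eqP; congruence.
Qed.

Lemma mem_tits_edge v x : (v \in tits_edge x) = (v == tits_vertex (tits_type v) x).
Proof. by case: v => C; rewrite !inE /=; case: eqP. Qed.

Lemma tits_edge_mem e x : tits_vertex e x \in tits_edge x.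
Proof. by rewrite mem_tits_edge tits_typeE. Qed.

Lemma titsP s :
  reflect (s != finset.set0 /\ exists x, s \subset tits_edge x) (s \in D).
Proof.
apply: (iffP idP) => [|[s0 [x sx]]].
  rewrite !inE -orbA => /or3P[] /imsetP[x _ ->]; split.
  - by apply/set0Pn; exists (inl (J :* x)); rewrite inE.
  - by exists x; rewrite finset.sub1set (tits_edge_mem true).
  - by apply/set0Pn; exists (inr (K :* x)); rewrite inE.
  - by exists x; rewrite finset.sub1set (tits_edge_mem false).
  - by apply/set0Pn; exists (inl (J :* x)); rewrite !inE eqxx.
  - by exists x; apply: fintype.subxx.
rewrite !inE -orbA; have [/set0Pn[v sv] /fintype.subsetP sE] := (s0, sx).
have sub u : u \in s -> u = tits_vertex (tits_type u) x.
  by move=> /sE; rewrite mem_tits_edge => /eqP.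
have single e : tits_vertex (~~ e) x \notin s -> s = [set tits_vertex e x].
  move=> ne; have se u : u \in s -> u = tits_vertex e x.
    move=> su; have := sub u su; have [->//|te] := eqVneq (tits_type u) e.
    have -> : tits_type u = ~~ e by move: te; clear; case: (tits_type u); case: e.
    by move=> uE; rewrite -uE su in ne.
  apply/setP=> u; rewrite inE; apply/idP/eqP => [/se //|->].
  by rewrite -(se v sv).
apply/or3P; have [st|nst] := boolP (tits_vertex true x \in s); last first.
  by apply: Or32; apply/imsetP; exists x; rewrite ?inE // (single false).
have [sf|nsf] := boolP (tits_vertex false x \in s); last first.
  by apply: Or31; apply/imsetP; exists x; rewrite ?inE // (single true).
apply: Or33; apply/imsetP; exists x; rewrite ?inE //.
apply/setP=> u; rewrite !inE; apply/idP/orP => [/sub ->|[/eqP->|/eqP->]] //.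
by case: (tits_type u); [left|right]; apply/eqP.
Qed.

Lemma tits_act_edge s x a : s \subset tits_edge x ->
  to^* s a \subset tits_edge (x * a).
Proof.
move=> /fintype.subsetP sx; apply/fintype.subsetP => u; rewrite mem_setact_inv => /sx.
rewrite !mem_tits_edge tits_type_act => /eqP e.
by apply/eqP; rewrite -tits_vertex_act -e actKV.
Qed.

Lemma tits_acts s a : s \in D -> to^* s a \in D.
Proof.
move=> /titsP[/set0Pn[v sv] [x sx]]; apply/titsP; split.
  by apply/set0Pn; exists (to v a); rewrite mem_setact_inv actK.
by exists (x * a); apply: tits_act_edge.
Qed.

Lemma tits_type_inj s u v :
  s \in D -> u \in s -> v \in s -> tits_type u = tits_type v -> u = v.
Proof.
move=> /titsP[_ [x /fintype.subsetP sx]] /sx + /sx.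
by rewrite !mem_tits_edge => /eqP -> /eqP ->; rewrite !tits_typeE => ->.
Qed.

Lemma tits_closed (s t : {set ({set gT} + {set gT})}) :
  s \in D -> t \subset s -> t != finset.set0 -> t \in D.
Proof.
move=> /titsP[_ [x sx]] ts t0; apply/titsP; split=> //; exists x.
exact: fintype.subset_trans ts sx.
Qed.

Lemma tits_set0 : finset.set0 \notin D.
Proof. by apply/titsP => -[]; rewrite eqxx. Qed.

Lemma tits_gcomplex : gcomplex to D.
Proof.
split.
- exact: tits_set0.
- exact: tits_closed.
- apply/fintype.subsetP => a _; apply/astabsP => s.
  by apply/idP/idP => [/(tits_acts a^-1)|sD]; rewrite ?actK //; apply: tits_acts.
- move=> s sD; apply/fintype.subsetP => a /astabsP sa; apply/astabP => v sv.
  by apply: (tits_type_inj sD) => //; rewrite ?sa ?tits_type_act.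
Qed.

Lemma tits_vertexP v :
  reflect (exists x, v = tits_vertex (tits_type v) x) ([set v] \in D).
Proof.
apply: (iffP (titsP _)) => [[_ [x]]|[x vE]].
  by rewrite finset.sub1set mem_tits_edge => /eqP; exists x.
split; first by apply/set0Pn; exists v; rewrite inE.
by exists x; rewrite finset.sub1set mem_tits_edge -vE.
Qed.

Lemma tits_fixP (P : {set gT}) e x :
  (tits_vertex e x \in 'Fix_to(P)) = (P \subset parabolic e :^ x).
Proof.
apply/afixP/fintype.subsetP => h u Pu.
  have := h u Pu; rewrite tits_vertex_act => /eqP.
  by rewrite tits_vertex_eq mem_conjg conjgE invgK mulgA.
rewrite tits_vertex_act; apply/eqP; rewrite tits_vertex_eq.
by have := h u Pu; rewrite mem_conjg conjgE invgK mulgA.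
Qed.

Lemma tits_edgeP u v : [set u; v] \in D -> u != v ->
  exists x, u = tits_vertex (tits_type u) x /\ v = tits_vertex (~~ tits_type u) x.
Proof.
move=> uvD; have u2 : u \in [set u; v] by rewrite !inE eqxx.
have v2 : v \in [set u; v] by rewrite !inE eqxx orbT.
move=> uv; have [_ [x /fintype.subsetP xs]] := titsP _ uvD; exists x.
have := (xs _ u2); have := xs _ v2; rewrite !mem_tits_edge => /eqP vE /eqP uE.
split=> //; have [tt|] := eqVneq (tits_type u) (tits_type v).
  by case/eqP: uv; apply: tits_type_inj uvD _ _ tt.
by move: vE; case: (tits_type u) uE; case: (tits_type v).
Qed.

Lemma tits_edge_in e x : [set tits_vertex e x; tits_vertex (~~ e) x] \in D.
Proof.
apply/titsP; split; first by apply/set0Pn; exists (tits_vertex e x);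
  rewrite !inE eqxx.
exists x; apply/fintype.subsetP => v; rewrite !inE => /orP[]/eqP->; case: e;
  rewrite ?eqxx ?orbT //.
Qed.

End Tits.

Section GComplex.
Variables (gT : finGroupType) (V : finType) (to : {action gT &-> V}).
Implicit Types (D : {set {set V}}) (s t : {set V}).

Lemma gcomplex_act D s a : gcomplex to D -> s \in D -> (to^*)%act s a \in D.
Proof.
by case=> _ _ actD _ sD; rewrite (astabs_act _ (fintype.subsetP actD a _)) // inE.
Qed.

Lemma fixed_complex1 D : fixed_complex to D 1%g = D.
Proof.
apply/setP=> s; rewrite inE; case: (s \in D) => //=.
by apply/fintype.subsetP => v _; apply/afixP => a /set1P->; rewrite act1.
Qed.

End GComplex.

(** * The Tits building as a synthetic building *)

Section TitsBuilding.
Variables (R : realType) (gT : finGroupType) (p : nat) (B J K U : {group gT}).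
Local Notation D := (tits_building J K).
Local Notation to := (tits_act gT).
Local Notation parabolic := (parabolic J K).
Local Notation tits_vertex := (tits_vertex J K).
Local Notation tits_edge := (tits_edge J K).
Local Open Scope group_scope.
Hypotheses (JK : lie_rank2 B J K) (F : rank2_parabolics p B J K U).

Lemma parabolic_sup e : B \subset parabolic e.
Proof. by case: e; [apply: rank2_sub JK|apply: rank2_sub (lie_rank2_sym JK)]. Qed.

Lemma parabolicI : B = parabolic true :&: parabolic false :> {set gT}.
Proof. by case: JK. Qed.

Lemma parabolic_not_sub e : ~~ (parabolic e \subset parabolic (~~ e)).
Proof.
have h J' K' : lie_rank2 B J' K' -> ~~ (J' \subset K').
  case=> neq mx BE; apply/negP => JK'.
  have [/maxgroupP[pJ maxJ] _] := (mx J').2 (or_introl erefl).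
  have [/maxgroupp pK _] := (mx K').2 (or_intror erefl).
  by case/eqP: neq; apply/val_inj/esym/maxJ.
by case: e; apply: h => //; apply: lie_rank2_sym.
Qed.

Lemma sylow_sub_Borel : U \subset B.
Proof. by rewrite -(parab_norm F) normG. Qed.

(** [U] is a Sylow subgroup of [parabolic e] too, so a p-subgroup fixing a vertex lies in a
    conjugate of [U] within the stabilizer and fixes a chamber at this vertex. *)
Lemma parabolic_fixed_chamber (P : {group gT}) e x :
  p.-group P -> P \subset parabolic e :^ x ->
  exists2 y, P \subset B :^ y & tits_vertex e y = tits_vertex e x.
Proof.
move=> pP Px; have sU := fintype.subset_trans sylow_sub_Borel (parabolic_sup e).
have sylU : p.-Sylow(parabolic e) U by apply: pHall_subl (parab_Sylow F);
  rewrite ?finset.subsetT.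
have [||j Qj Pj] := Sylow_subJ sylU (Q := (P :^ x^-1)%G).
- by rewrite sub_conjgV.
- by rewrite pgroupJ.
exists (j * x).
  rewrite conjsgM -sub_conjgV; apply: fintype.subset_trans Pj _.
  by rewrite conjSg sylow_sub_Borel.
by apply/eqP; rewrite tits_vertex_eq mulgK.
Qed.

Lemma fixed_chamber_vertex (P : {set gT}) e x :
  P \subset B :^ x -> tits_vertex e x \in 'Fix_to(P).
Proof.
move=> Px; rewrite tits_fixP; apply: fintype.subset_trans Px _.
by rewrite conjSg parabolic_sup.
Qed.

Lemma fixed_edge_chamber (P : {set gT}) x :
  (forall e, tits_vertex e x \in 'Fix_to(P)) -> P \subset B :^ x.
Proof.
move=> fx; rewrite parabolicI conjIg finset.subsetI.
by rewrite -!tits_fixP !fx.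
Qed.

Lemma tits_fixed_contractible (P : {group gT}) : p.-group P -> P :!=: 1 ->
  gcontractible R 'N(P) to (fixed_complex to D P).
Proof.
move=> pP P1.
pose T := [set v in 'Fix_to(P) | [set v]%SET \in D]%SET.
have -> : fixed_complex to D P = subcomplex_on D T.
  apply/setP=> s; rewrite [LHS]inE [RHS]inE; case sD: (s \in D) => //=.
  apply/fintype.subsetP/fintype.subsetP => h v sv; last first.
    by have := h v sv; rewrite inE => /andP[].
  rewrite inE h //=; apply: tits_closed sD _ _; first by rewrite finset.sub1set.
  by apply/set0Pn; exists v; rewrite inE.
have memT e x : (tits_vertex e x \in T) = (P \subset parabolic e :^ x).
  rewrite inE tits_fixP; have -> : [set tits_vertex e x]%SET \in D.
    by apply/tits_vertexP; exists x; rewrite tits_typeE.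
  by rewrite andbT.
have TP v : v \in T -> exists2 y, P \subset B :^ y & v = tits_vertex (tits_type v) y.
  move=> Tv; have := Tv; rewrite inE => /andP[_ /tits_vertexP[x vE]].
  move: Tv; rewrite vE memT tits_typeE => Px.
  by have [y Py yx] := parabolic_fixed_chamber pP Px; exists y.
have BT e x : P \subset B :^ x -> tits_vertex e x \in T.
  by move=> Px; rewrite memT -tits_fixP fixed_chamber_vertex.
apply: (@tree_contractible R gT _ to D 'N(P)%G (@tits_type gT)).
- exact: tits_set0.
- exact: tits_closed.
- by move=> s a sD _; apply: tits_acts.
- by move=> v a _; apply: tits_type_act.
- exact: tits_type_inj.
- have [x _ Px] := Sylow_subJ (parab_Sylow F) (finset.subsetT P) pP.
  apply/set0Pn; exists (tits_vertex true x); apply: BT.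
  by apply: fintype.subset_trans Px _; rewrite conjSg sylow_sub_Borel.
- by move=> v; rewrite inE => /andP[].
- move=> v a; rewrite ![_ \in T]inE => /andP[/afixP fv vD] nPa; apply/andP; split.
    apply/afixP => u Pu; rewrite -actM.
    have Pu' : u ^ a^-1 \in P by rewrite memJ_norm ?groupV.
    by rewrite -{2}(fv _ Pu') -actM conjgE invgK -!mulgA mulVg mulg1.
  have /titsP[_ [x]] := tits_acts a vD => sx.
  apply/titsP; split; first by apply/set0Pn; exists (to v a); rewrite inE.
  exists x; apply: fintype.subset_trans sx; rewrite finset.sub1set.
  by rewrite mem_setact_inv actK inE.
- move=> S ST /set0Pn[u0 Su0] SnT; apply: contrapT => nocross.
  have cross u w : u \in S -> w \in T -> [set u; w]%SET \in D -> w \in S.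
    move=> Su Tw uw; apply: contrapT => Sw; apply: nocross.
    by exists u, w; split=> //; apply/negP.
  have [g Pg u0E] := TP u0 (fintype.subsetP ST _ Su0).
  have spread e x : P \subset B :^ x -> tits_vertex e x \in S ->
    forall e', tits_vertex e' x \in S.
    move=> Px Sx e'; have [->//|ne] := eqVneq e' e.
    have -> : e' = ~~ e by move: ne; clear; case: e; case: e'.
    apply: cross Sx _ _; first exact: BT.
    exact: tits_edge_in.
  case/eqP: SnT; apply/eqP; rewrite finset.eqEsubset ST;
    apply/fintype.subsetP => w Tw.
  have [x Px wE] := TP w Tw; rewrite wE; move: (tits_type w).
  apply: (parab_connected F (C :=
    fun x => forall e, tits_vertex e x \in S) Pg _ _ Px).
    by apply: (spread (tits_type u0)) => //; rewrite -u0E.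
  move=> y z Cy Pz yz.
  have [e ze] : exists e, z * y^-1 \in parabolic e by case: yz;
    [exists true|exists false].
  apply: (spread e) => //.
  by move: ze; rewrite -tits_vertex_eq => /eqP->.
- move=> S ST /set0Pn[u0 Su0]; apply/exists_inP; apply: contraT.
  rewrite negb_exists_in => /forall_inP deg2.
  pose E := [set x | (tits_vertex true x \in S) && (tits_vertex false x \in S)]%SET.
  have inE' x e : x \in E -> tits_vertex e x \in S by rewrite inE => /andP[]; case: e.
  have EI x e : tits_vertex e x \in S -> tits_vertex (~~ e) x \in S -> x \in E.
    by move=> h h'; rewrite inE; case: e h h' => /= -> ->.
  have EP : {in E, forall x, P \subset B :^ x}.
    move=> x Ex; apply: fixed_edge_chamber => e.
    by have := fintype.subsetP ST _ (inE' x e Ex); rewrite inE => /andP[].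
  have nbrE v : v \in S -> exists2 x, x \in E & v = tits_vertex (tits_type v) x.
    move=> Sv; have : nbrs D S v != finset.set0.
      by rewrite -card_gt0; apply: leq_ltn_trans (ltnW _); last by rewrite ltnNge;
        apply: deg2.
    move=> /set0Pn[w]; rewrite inE => /and3P[Sw wv vw].
    have [|x [vE wE]] := tits_edgeP vw; first by rewrite eq_sym.
    by exists x => //; apply: (EI x (tits_type v)); rewrite -?vE -?wE.
  have [g Eg _] := nbrE u0 Su0.
  have [x Ex ext] := parab_extremal F pP P1 EP Eg.
  have [e exte] : exists e, forall z, z \in E -> z * x^-1 \in parabolic e ->
    z * x^-1 \in B.
    by case: ext; [exists true|exists false].
  (* The vertex of type [e] of the chamber [x] has only one neighbour in [S]: another one would give
     a further chamber of [E] in the same panel. *)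
  have Sx := inE' x e Ex; case/negP: (deg2 _ Sx).
  rewrite -(cards1 (tits_vertex (~~ e) x)); apply: subset_leq_card.
  apply/fintype.subsetP => w; rewrite [_ \in nbrs _ _ _]inE => /and3P[Sw wx xw];
    rewrite inE; apply/eqP.
  have [|z [xE wE]] := tits_edgeP xw; first by rewrite eq_sym.
  rewrite tits_typeE in xE wE.
  have Ez : z \in E by apply: (EI z e); rewrite -?wE // -xE.
  have : z * x^-1 \in parabolic e by rewrite -tits_vertex_eq xE.
  move=> /(exte z Ez) Bz; apply/eqP; rewrite wE tits_vertex_eq.
  exact: (fintype.subsetP (parabolic_sup _)).
Qed.

Lemma tits_stab_dvd s : s \in D -> p %| #|'N(s | to)|.
Proof.
move=> /titsP[_ [x /fintype.subsetP sx]].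
have : U :^ x \subset 'N(s | to).
  apply: fintype.subset_trans (_ : B :^ x \subset _).
    by rewrite conjSg sylow_sub_Borel.
  apply: fintype.subset_trans (astab_sub _ _).
  apply/fintype.subsetP => b Bb; apply/astabP => v /sx.
  rewrite mem_tits_edge => /eqP ->.
  by have /afixP := fixed_chamber_vertex (tits_type v) (fintype.subxx (B :^ x));
    apply.
move=> /cardSg; rewrite cardJg; apply: dvdn_trans.
have [] := pgroup_pdiv (pHall_pgroup (parab_Sylow F)) (parab_neq1 F).
by [].
Qed.

Lemma tits_synthetic : synthetic_building R p to D.
Proof.
split; [exact: tits_gcomplex|exact: tits_fixed_contractible|exact: tits_stab_dvd].
Qed.

(** A Frattini argument: [U] and [U :^ x^-1] are both Sylow in [parabolic e], so some [j] in it
    makes [j * x] normalize [U]. Then [j * x] is in ['N(U) = B], and [x] is in [parabolic e]. *)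
Lemma tits_fixed_Borel e x :
  tits_vertex e x \in 'Fix_to(B) -> tits_vertex e x = tits_vertex e 1.
Proof.
rewrite tits_fixP => BP; apply/eqP; rewrite tits_vertex_eq invg1 mulg1.
have sU := fintype.subset_trans sylow_sub_Borel (parabolic_sup e).
have sylU : p.-Sylow(parabolic e) U by apply: pHall_subl (parab_Sylow F);
  rewrite ?finset.subsetT.
have [||j Qj Uj] := Sylow_subJ sylU (Q := (U :^ x^-1)%G).
- by rewrite sub_conjgV (fintype.subset_trans sylow_sub_Borel).
- by rewrite pgroupJ (pHall_pgroup (parab_Sylow F)).
have : j * x \in B.
  rewrite -(parab_norm F); apply/normP/esym/eqP.
  by rewrite finset.eqEcard cardJg leqnn andbT conjsgM -sub_conjgV.
move=> /(fintype.subsetP (parabolic_sup e)); rewrite groupMl //.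
Qed.

Lemma tits_nontrivial : nontrivial_complex R to D.
Proof.
(* As the trivial subgroup fixes all of [D], the criterion for fixed vertices applies to [D] itself:
   a contraction would give a vertex fixed by the whole group. *)
move=> triv; have {}triv : gcontractible R [set: gT] to (fixed_complex to D 1%G).
  by rewrite fixed_complex1.
have [v [/tits_vertexP[x ->] _]] :=
  gcontractible_fixed_vertex (A := [set: gT]%G) (tits_gcomplex J K) triv.
rewrite tits_fixP => /fintype.subsetP Tx.
have /negP[] := parabolic_not_sub (~~ tits_type v).
rewrite negbK; apply/fintype.subsetP => y _.
by rewrite -(memJ_conjg _ x) Tx ?finset.in_setT.
Qed.

(** * Minimality of the Tits building *)

Section Minimal.
Variable D' : {set {set ({set gT} + {set gT})}}.
Hypotheses (sD'D : D' \subset D) (synD' : synthetic_building R p to D').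

(** The fixed points of a p-subgroup [Q] normal in [parabolic e] yield a vertex of [D'] fixed by
    [parabolic e]. Being fixed by [B], it is one of the two vertices of the base chamber, and the
    one of the other type has the wrong stabilizer. *)
Lemma sub_synthetic_vertex e : [set tits_vertex e 1]%SET \in D'.
Proof.
have [gD' cD' _] := synD'.
have [Q [pQ Q1 nQ]] : exists Q : {group gT}, [/\ p.-group Q,
  Q :!=: 1 & normal Q (parabolic e)].
  by case: e; [apply: parab_radical F|apply: parab_radical2 F].
have [v [D'v _ fv]] := gcontractible_fixed_vertex gD' (cD' Q pQ Q1).
have /tits_vertexP[x vE] := fintype.subsetP sD'D _ D'v.
have fQ : v \in 'Fix_to(parabolic e).
  by apply: fintype.subsetP fv; apply/afixS/normal_norm.
have vE1 : v = tits_vertex (tits_type v) 1.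
  rewrite {1}vE; apply: tits_fixed_Borel; rewrite -vE.
  by apply: fintype.subsetP fQ; apply/afixS/parabolic_sup.
have [te|te] := eqVneq (tits_type v) e; first by rewrite -te -vE1.
have tE : tits_type v = ~~ e by move: te; clear; case: (tits_type v); case: e.
move: fQ; rewrite vE1 tits_fixP conjsg1 tE.
by rewrite (negbTE (parabolic_not_sub e)).
Qed.

(** The two vertices of the base chamber are joined in [D'] by a path of [B]-fixed vertices. There
    are no [B]-fixed vertices besides these two, so the path uses the edge between them, and the
    translates of this edge make up [D]. *)
Lemma sub_synthetic_eq : D' = D.
Proof.
have [gD' cD' _] := synD'.
have pU := pHall_pgroup (parab_Sylow F); have U1 := parab_neq1 F.
have fB e : tits_vertex e 1 \in 'Fix_to(B).
  by apply: fixed_chamber_vertex; rewrite conjsg1.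
have fU e : [set tits_vertex e 1]%SET \in fixed_complex to D' U.
  rewrite inE sub_synthetic_vertex finset.sub1set.
  by apply: fintype.subsetP (fB e); apply/afixS/sylow_sub_Borel.
have cU : gcontractible R B to (fixed_complex to D' U).
  by rewrite -(parab_norm F); apply: cD'.
have := gcontractible_fixed_connected gD' cU (fU true) (fB true) (fU false) (fB
  false).
move=> /connectP[q]; set e := (X in path X).
have [edge _ _|noedge] := boolP (tits_edge 1 \in D').
  apply/eqP; rewrite finset.eqEsubset sD'D; apply/fintype.subsetP => s.
  move=> /titsP[s0 [x sx]]; have [_ clD' _ _] := gD'.
  apply: clD' (gcomplex_act x gD' edge) _ s0.
  apply/fintype.subsetP => v /(fintype.subsetP sx).
  rewrite mem_tits_edge mem_setact_inv mem_tits_edge tits_type_act => /eqP->.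
  by rewrite tits_vertex_act mulgV tits_typeE.
suff stay : path e (tits_vertex true 1) q ->
    last (tits_vertex true 1) q = tits_vertex true 1.
  by move=> /stay -> /eqP; rewrite eq_sym.
elim: q => [|w q' IH] //= /andP[/and3P[D'w _ fw] pq].
have Dw : [set w]%SET \in D.
  apply: tits_closed (fintype.subsetP sD'D _ D'w) _ _.
    by apply/fintype.subsetP => u; rewrite !inE => ->; rewrite orbT.
  by apply/set0Pn; exists w; rewrite inE.
have /tits_vertexP[x wE] := Dw.
have {}wE : w = tits_vertex (tits_type w) 1.
  by rewrite {1}wE; apply: tits_fixed_Borel; rewrite -wE.
case tw: (tits_type w); rewrite tw in wE.
  by rewrite wE in pq *; apply: IH.
by move: noedge; rewrite -[tits_edge
  1]/([set tits_vertex true 1; tits_vertex false 1]%SET) -wE D'w.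
Qed.

End Minimal.

Lemma tits_minimal : minimal_synthetic_building R p to D.
Proof.
split; first exact: tits_synthetic.
move=> D' ltD' synD'; have := sub_synthetic_eq (proper_sub ltD') synD'.
by move=> D'D; move: ltD'; rewrite D'D fintype.properxx.
Qed.

End TitsBuilding.

(** * Uniqueness *)

Section Transfer.
Local Open Scope ring_scope.
Variables (R : realType) (gT : finGroupType) (V1 V2 : finType).
Variables (to1 : {action gT &-> V1}) (to2 : {action gT &-> V2}).
Variables (D1 : {set {set V1}}) (D2 : {set {set V2}}).
Variables (f : {ptws V1 -> R} -> {ptws V2 -> R}) (g : {ptws V2 -> R} -> {ptws V1 ->
  R}).
Hypotheses (gD1 : gcomplex to1 D1) (gD2 : gcomplex to2 D2).
Hypotheses (mf : gmap [set: gT] to1 D1 to2 D2 f) (mg : gmap [set: gT] to2 D2 to1 D1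
  g).
Hypotheses (gf : forall x, realization R D1 x -> g (f x) = x).
Hypotheses (fg : forall y, realization R D2 y -> f (g y) = y).

Lemma homeo_ghomotopy_equiv : ghomotopy_equiv R [set: gT] to1 D1 to2 D2.
Proof.
have [cf fD fA] := mf; have [cg gD gA] := mg.
exists f, g; split=> //; apply: ghomotopic_refl => //; split.
- exact: (within_continuous_comp_sub cf cg).
- by move=> x Dx; apply/gD/fD.
- by move=> x a Dx aG /=; rewrite fA // gA //; exact: fD.
- exact: (within_continuous_comp_sub cg cf).
- by move=> x Dx; apply/fD/gD.
- by move=> x a Dx aG /=; rewrite gA // fA //; exact: gD.
Qed.

(** Equivariance makes [f] and [g] preserve the points fixed by [P], so they restrict to the fixed
    complexes and conjugate one contraction into the other. *)
Lemma homeo_gcontractible (A P : {group gT}) :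
  gcontractible R A to2 (fixed_complex to2 D2 P) ->
  gcontractible R A to1 (fixed_complex to1 D1 P).
Proof.
have [cf fD fA] := mf; have [cg gD gA] := mg.
move=> /gcontractibleP[y [Dy fy [h [ch hm h0 h1]]]].
have sub1 x : realization R (fixed_complex to1 D1 P) x -> realization R D1 x.
  by move=> /(realization_fixed_complex _ _ gD1)[].
have sub2 x : realization R (fixed_complex to2 D2 P) x -> realization R D2 x.
  by move=> /(realization_fixed_complex _ _ gD2)[].
have f12 x : realization R (fixed_complex to1 D1 P) x ->
    realization R (fixed_complex to2 D2 P) (f x).
  move=> /(realization_fixed_complex _ _ gD1)[Dx fx].
  apply/(realization_fixed_complex _ _ gD2); split; first exact: fD.
  by move=> a Pa; rewrite -fA ?inE // fx.
have g21 x : realization R (fixed_complex to2 D2 P) x ->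
    realization R (fixed_complex to1 D1 P) (g x).
  move=> /(realization_fixed_complex _ _ gD2)[Dx fx].
  apply/(realization_fixed_complex _ _ gD1); split; first exact: gD.
  by move=> a Pa; rewrite -gA ?inE // fx.
have cf' : {within realization R (fixed_complex to1 D1 P), continuous f}%classic.
  exact: continuous_subspaceW cf.
have cg' : {within realization R (fixed_complex to2 D2 P), continuous g}%classic.
  exact: continuous_subspaceW cg.
apply/gcontractibleP; exists (g y); split; first exact: g21.
  by move=> a Aa; rewrite -gA ?inE ?fy //; exact: sub2.
exists (fun tx => g (h (tx.1, f tx.2))); split.
- pose k tx := h (tx.1, f tx.2); apply: (within_continuous_comp_sub (f := k) _ cg').
    apply: (within_continuous_comp_sub (f := fun tx => (tx.1, f tx.2)) _ ch).
      apply: within_continuous_pair; first exact: within_fst.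
      apply: (within_continuous_comp_sub (f := snd) _ cf'); first exact: within_snd.
      by move=> [t x] [].
    by move=> [t x] [t01 Dx]; split=> //; exact: f12.
  move=> [t x] [/=]; rewrite in_itv /= => t01 Dx.
  by have [_ hD _] := hm t t01; apply/hD/f12.
- move=> t t01; have [cht hD hA] := hm t t01; split.
  + apply: (within_continuous_comp_sub (f := fun x => h (t, f x)) _ cg').
      exact: (within_continuous_comp_sub cf' cht).
    by move=> x /f12 /hD.
  + by move=> x /f12 /hD /g21.
  + move=> x a Dx Aa /=; rewrite fA ?inE //; last exact: sub1.
    by rewrite hA ?gA ?inE //; [apply/sub2/hD/f12|apply: f12].
- by move=> x /f12 Dx /=; rewrite h0.
- by move=> x Dx /=; rewrite h1 ?gf //; [apply: sub1|apply: f12].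
Qed.

End Transfer.

(** * Edges and their subdivisions *)

Section Segment.
Local Open Scope ring_scope.
Variables (R : realType) (V : finType).
Implicit Types (u w : V) (c : R).

Definition segment u w c : {ptws V -> R} :=
  fun x => vertex_point R u x + c * (vertex_point R w x - vertex_point R u x).

Lemma segment0 u w : segment u w 0 = vertex_point R u.
Proof. by apply/funext => x; rewrite /segment mul0r addr0. Qed.

Lemma segment1 u w : segment u w 1 = vertex_point R w.
Proof. by apply/funext => x; rewrite /segment mul1r addrC subrK. Qed.

Lemma realization_segment (D : {set {set V}}) u w c :
  (forall s t : {set V}, s \in D -> t \subset s -> t != finset.set0 -> t \in D) ->
  [set u; w]%SET \in D -> 0 <= c <= 1 -> realization R D (segment u w c).
Proof.
move=> clD uwD c01.
have in2 v : v \in [set u; w]%SET -> [set v]%SET \in D.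
  move=> v2; apply: clD uwD _ _; first by rewrite finset.sub1set.
  by apply/set0Pn; exists v; rewrite inE.
apply: realization_convex => //.
- by apply/realization_vertex/in2; rewrite !inE eqxx.
- by apply/realization_vertex/in2; rewrite !inE eqxx orbT.
- by move=> s s0; rewrite !supp_vertex_point => ss; apply: clD uwD ss s0.
Qed.

Lemma realization_segmentP (D : {set {set V}}) (x : {ptws V -> R}) u w :
  realization R D x -> u != w -> supp x \subset [set u; w]%SET ->
  exists2 c, 0 <= c <= 1 & x = segment u w c.
Proof.
move=> [x0 x1 _] uw /fintype.subsetP sx.
have xv v : v != u -> v != w -> x v = 0.
  move=> vu vw; apply/eqP; have := sx v; rewrite !inE (negbTE vu) (negbTE vw).
  by case: (x v == 0) => // /(_ isT).
have xuw : x u + x w = 1.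
  rewrite -x1 (bigD1 u) //= (bigD1 w) 1?eq_sym //= big1 ?addr0 //.
  by move=> v /andP[vu vw]; apply: xv.
have := x0 u; have := x0 w => xw0 xu0.
exists (x w); first by apply/andP; split; lra.
apply/funext => v; rewrite /segment /vertex_point.
have [->|vu] := eqVneq v u; first by rewrite (negbTE uw) /=; lra.
have [->|vw] := eqVneq v w; first by rewrite /=; lra.
by rewrite xv //=; lra.
Qed.

Lemma ract_segment (gT : finGroupType) (to : {action gT &-> V}) u w c a :
  ract to (segment u w c) a = segment (to u a) (to w a) c.
Proof.
apply/funext => v; rewrite /ract /segment /vertex_point.
by rewrite !(canF_eq (actKV to a)).
Qed.

End Segment.

Section Tent.
Local Open Scope ring_scope.
Variable R : realType.

Lemma unit_subdivision n (z : R) : (0 < n)%N -> 0 <= z <= n%:R ->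
  exists2 i, (i < n)%N & i%:R <= z <= i%:R + 1.
Proof.
elim: n => // n IH _ /andP[z0 zn].
have [n0|n_gt0] := posnP n.
  by exists 0%N => //; move: zn; rewrite n0 -natr1 => zn; apply/andP; split; lra.
have [le|lt] := leP z n%:R.
  have [|i ltin iz] := IH n_gt0; first by rewrite z0.
  by exists i => //; apply: leq_trans ltin _.
by exists n => //; rewrite (ltW lt) /= natr1.
Qed.

(* On the edge joining the two ends of a subdivided segment, where
   [a + b = 1], this is the hat function of the [j]-th subdivision point; it
   vanishes for [0 < j < n] as soon as [a] or [b] does. *)
Definition hat (n j : nat) (a b : R) : R :=
  Num.max 0 (Num.min (n%:R * b - j%:R + 1) (n%:R * a - (n%:R - j%:R) + 1)).

(** The point with parameter [c] lies between the subdivision points [i] and [i.+1]; the right-hand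
    side gives its barycentric coordinates there, [i + 1 - z] and [z - i]. *)
Lemma hat_edge n i j (z c : R) : i%:R <= z <= i%:R + 1 -> n%:R * c = z ->
  hat n j (1 - c) c = (j == i)%:R * (i%:R + 1 - z) + (j == i.+1)%:R * (z - i%:R).
Proof.
move=> /andP[iz zi] ncz; rewrite /hat mulrBr mulr1 ncz.
have -> : n%:R - z - (n%:R - j%:R) + 1 = j%:R + 1 - z by ring.
have [ji|ij|ji] := ltngtP j i.
- have ji' : j%:R + 1 <= i%:R :> R by rewrite natr1 ler_nat.
  rewrite (_ : (j == i.+1) = false); last by apply/negP => /eqP; lia.
  by rewrite min_r ?max_l /=; lra.
- have [jE|ne] := eqVneq j i.+1.
    by rewrite jE -natr1 min_l ?max_r /=; lra.
  have ij' : i%:R + 2 <= j%:R :> R by rewrite -natrD ler_nat; lia.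
  by rewrite min_l ?max_l /=; lra.
- rewrite ji (_ : (i == i.+1) = false); last by apply/negP => /eqP; lia.
  by rewrite min_r ?max_r /=; lra.
Qed.

Lemma hat_b0 n j (a : R) : (j <= n)%N -> a <= 1 -> (0 < j)%N -> hat n j a 0 = 0.
Proof.
move=> jn a1 j0; have j1 : 1 <= j%:R :> R by rewrite ler1n.
by rewrite /hat max_l // ge_min mulr0 sub0r; apply/orP; left; lra.
Qed.

Lemma hat_a0 n j (b : R) : (j < n)%N -> hat n j 0 b = 0.
Proof.
move=> jn; have j1 : j%:R + 1 <= n%:R :> R by rewrite natr1 ler_nat.
by rewrite /hat max_l // ge_min mulr0 sub0r; apply/orP; right; lra.
Qed.

(** The end vertex [v 0] determines its representative only up to [J], which leaves the coordinate
    [b] at the coset of [K] ambiguous; the hat function has to ignore it. [hat_nn] does the same for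
    the other end. *)
Lemma hat_00 n (a b b' : R) : 0 <= b -> 0 <= b' -> a <= 1 ->
  hat n 0 a b = hat n 0 a b'.
Proof.
move=> b0 b0' a1; have n0 : 0 <= n%:R :> R by rewrite ler0n.
have h c : 0 <= c -> n%:R * a - (n%:R - 0) + 1 <= n%:R * c - 0 + 1 :> R.
  move=> c0; have := mulr_ge0 n0 c0;
    have : n%:R * a <= n%:R * 1 :> R by rewrite ler_wpM2l.
  lra.
by rewrite /hat !min_r ?h.
Qed.

Lemma hat_nn n (a a' b : R) : 0 <= a -> 0 <= a' -> b <= 1 ->
  hat n n a b = hat n n a' b.
Proof.
move=> a0 a0' b1; have n0 : 0 <= n%:R :> R by rewrite ler0n.
have h c : 0 <= c -> n%:R * b - n%:R + 1 <= n%:R * c - (n%:R - n%:R) + 1 :> R.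
  move=> c0; have := mulr_ge0 n0 c0;
    have : n%:R * b <= n%:R * 1 :> R by rewrite ler_wpM2l.
  lra.
by rewrite /hat !min_l ?h.
Qed.

End Tent.

(** * The translates of a path as a subdivision of the Tits building *)

Section PathComplex.
Local Open Scope ring_scope.
Variables (R : realType) (gT : finGroupType) (J K : {group gT}).
Variables (V : finType) (to : {action gT &-> V}) (v : nat -> V) (n : nat).

Definition path_stab i : {set gT} :=
  if i == 0%N then J else if i == n then K else (J :&: K)%SET.

Hypothesis n_gt0 : (0 < n)%N.
Hypothesis stab_v : forall i g, (i <= n)%N -> g \in path_stab i -> to (v i) g = v i.
Hypothesis orbit_v : forall i j g h, (i <= n)%N -> (j <= n)%N ->
  to (v i) g = to (v j) h -> i = j /\ (g * h^-1)%g \in path_stab i.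

Definition path_edge i g : {set V} := [set to (v i) g; to (v i.+1) g]%SET.

Definition path_complex : {set {set V}} :=
  [set s : {set V} | (s != finset.set0)
    && [exists ig : 'I_n * gT, s \subset path_edge ig.1 ig.2]]%SET.

Local Notation D := (tits_building J K).
Local Notation tits_vertex := (tits_vertex J K).
Local Notation tits_edge := (tits_edge J K).

Lemma path_complexP s :
  reflect (s != finset.set0 /\ exists i g, (i < n)%N /\ s \subset path_edge i g)
    (s \in path_complex).
Proof.
rewrite inE; apply: (iffP andP) => -[s0 h]; split=> //.
  by have /existsP[[i g] /= sE] := h; exists i, g.
by have [i [g [lti sE]]] := h; apply/existsP; exists (Ordinal lti, g).
Qed.

Lemma path_vertex_eq i j g h : (i <= n)%N -> (j <= n)%N ->
  (to (v i) g == to (v j) h) = (i == j) && ((g * h^-1)%g \in path_stab i).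
Proof.
move=> lei lej; apply/eqP/andP => [/(orbit_v lei lej)[-> ->]|[/eqP<- gh]].
  by rewrite eqxx.
by rewrite -[g](mulgKV h) actM stab_v.
Qed.

Lemma path_edge_act i g a : (to^*)%act (path_edge i g) a = path_edge i (g * a)%g.
Proof. by rewrite /path_edge setact2 !actM. Qed.

Lemma path_complex_act s a : s \in path_complex -> (to^*)%act s a \in path_complex.
Proof.
move=> /path_complexP[/set0Pn[u su] [i [g [lti /fintype.subsetP sE]]]].
apply/path_complexP; split.
  by apply/set0Pn; exists (to u a); rewrite mem_setact_inv actK.
exists i, (g * a)%g; split=> //; apply/fintype.subsetP => w.
by rewrite -path_edge_act !mem_setact_inv => /sE.
Qed.

Lemma path_complex_closed (s t : {set V}) : s \in path_complex -> t \subset s ->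
  t != finset.set0 -> t \in path_complex.
Proof.
move=> /path_complexP[_ [i [g [lti sE]]]] ts t0; apply/path_complexP; split=> //.
by exists i, g; split=> //; apply: fintype.subset_trans ts sE.
Qed.

Lemma path_edge_neq i g : (i < n)%N -> to (v i) g != to (v i.+1) g.
Proof. by move=> lti; rewrite path_vertex_eq ?(ltnW lti) // (ltn_eqF (ltnSn i)). Qed.

(** Vertices with different indices are in different orbits, so an element stabilizing a simplex
    cannot exchange its vertices. *)
Lemma path_complex_gcomplex : gcomplex to path_complex.
Proof.
split.
- by apply/path_complexP => -[]; rewrite eqxx.
- exact: path_complex_closed.
- apply/fintype.subsetP => a _; apply/astabsP => s.
  by apply/idP/idP => [/(@path_complex_act _ a^-1%g)|sD]; rewrite ?actK //;
    apply: path_complex_act.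
- move=> s /path_complexP[_ [i [g [lti /fintype.subsetP sE]]]].
  apply/fintype.subsetP => a /astabsP sa; apply/astabP => u su.
  have rep w : w \in s -> exists2 k, (k <= n)%N & w = to (v k) g.
    by move=> /sE; rewrite !inE => /orP[] /eqP ->; [exists i => //;
      exact: ltnW|exists i.+1].
  have [k lek uE] := rep u su;
    have [l lel ua] : exists2 l, (l <= n)%N & to u a = to (v l) g.
    by apply: rep; rewrite sa.
  have kl : k = l by move: ua; rewrite uE -actM => /orbit_v[].
  by rewrite ua -kl -uE.
Qed.

Lemma realization_path x : realization R path_complex x ->
  exists i g (c : R), [/\ (i < n)%N, 0 <= c <= 1 &
    x = segment (to (v i) g) (to (v i.+1) g) c].
Proof.
move=> Dx; have [_ _ /path_complexP[_ [i [g [lti sE]]]]] := Dx.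
have [c c01 xE] := realization_segmentP Dx (path_edge_neq g lti) sE.
by exists i, g, c.
Qed.

Lemma path_segment i g (c : R) : (i < n)%N -> 0 <= c <= 1 ->
  realization R path_complex (segment (to (v i) g) (to (v i.+1) g) c).
Proof.
move=> lti c01; apply: realization_segment c01; first exact: path_complex_closed.
apply/path_complexP; split; last by exists i, g.
by apply/set0Pn; exists (to (v i) g); rewrite !inE eqxx.
Qed.

Definition tits_segment g (c : R) :=
  segment (tits_vertex true g) (tits_vertex false g) c.

Lemma tits_segment_realization g (c : R) : 0 <= c <= 1 ->
  realization R D (tits_segment g c).
Proof.
by apply: realization_segment; [apply: tits_closed|apply: (tits_edge_in _ _ true)].
Qed.

Lemma realization_tits y : realization R D y ->
  exists g (c : R), 0 <= c <= 1 /\ y = tits_segment g c.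
Proof.
move=> Dy; have [_ _ /titsP[_ [g sE]]] := Dy.
have [|c c01 yE] := realization_segmentP Dy _ sE; first by [].
by exists g, c.
Qed.

Lemma tits_segment_true g h c :
  tits_segment g c (tits_vertex true h) = ((h * g^-1)%g \in J)%:R * (1 - c).
Proof.
rewrite /tits_segment /segment /vertex_point tits_vertex_eq /=.
by case: (_ \in J); rewrite /=; ring.
Qed.

Lemma tits_segment_false g h c :
  tits_segment g c (tits_vertex false h) = ((h * g^-1)%g \in K)%:R * c.
Proof.
rewrite /tits_segment /segment /vertex_point tits_vertex_eq /=.
by case: (_ \in K); rewrite /=; ring.
Qed.

Lemma ract_tits_segment g c a :
  ract (tits_act gT) (tits_segment g c) a = tits_segment (g * a)%g c.
Proof. by rewrite /tits_segment ract_segment !tits_vertex_act. Qed.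

(** The pair found is unique only up to the stabilizer: the index is determined, the group element
    modulo [path_stab] on the left. *)
Definition path_index (w : V) : option ('I_n.+1 * gT) :=
  [pick ig : 'I_n.+1 * gT | w == to (v ig.1) ig.2].

Lemma path_indexE j h : (j <= n)%N ->
  exists k h', [/\ path_index (to (v j) h) = Some (k, h'), val k = j
                 & (h * h'^-1)%g \in path_stab j].
Proof.
move=> lej; rewrite /path_index;
  case: pickP => [[k h'] /= /eqP e|/(_ (Ordinal (lej : (j < n.+1)%N), h))].
  have [jk hh] := orbit_v lej (leq_ord k) e.
  by exists k, h'.
by rewrite /= eqxx.
Qed.

(** The place of a vertex in the realization of the Tits building: [v i] translated by [g] goes to
    the fraction [i / n] of the edge of [g]. The value 0 serves vertices off the path complex. *)
Definition path_coef (w : V) : {ptws ({set gT} + {set gT})%type -> R} :=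
  if path_index w is Some (i, g) then tits_segment g (i%:R / n%:R) else fun=> 0.

Lemma path_coefE i g : (i <= n)%N ->
  path_coef (to (v i) g) = tits_segment g (i%:R / n%:R).
Proof.
move=> lei; have [k [h [kE ki]]] := path_indexE g lei.
rewrite /path_coef kE ki /path_stab /tits_segment.
case: eqP => [->|_]; first by rewrite mul0r !segment0 -(tits_vertex_eq J K true) =>
  /eqP->.
case: eqP => [->|_].
  by rewrite divff ?pnatr_eq0 ?(gtn_eqF n_gt0) // !segment1 -(tits_vertex_eq J K
    false) => /eqP->.
rewrite inE => /andP[]; rewrite -(tits_vertex_eq J K true) => /eqP->.
by rewrite -(tits_vertex_eq J K false) => /eqP->.
Qed.

Definition path_to_tits (x : {ptws V -> R}) : {ptws ({set gT} + {set gT})%type ->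
  R} :=
  fun u => \sum_w x w * path_coef w u.

(** One formula in coordinates, without a case distinction on the edge that contains [y]; continuity
    follows coordinatewise and needs no gluing. *)
Definition tits_to_path (y : {ptws ({set gT} + {set gT})%type -> R}) : {ptws V ->
  R} :=
  fun w => if path_index w is Some (j, h)
    then hat n j (y (tits_vertex true h)) (y (tits_vertex false h)) else 0.

Lemma path_to_tits_segment i g c : (i < n)%N ->
  path_to_tits (segment (to (v i) g) (to (v i.+1) g) c)
    = tits_segment g ((i%:R + c) / n%:R).
Proof.
move=> lti; apply/funext => u; rewrite /path_to_tits.
have sum_vp w (F : V -> R) : \sum_z vertex_point R w z * F z = F w.
  rewrite (bigD1 w) //= /vertex_point eqxx mul1r big1 ?addr0 //.
  by move=> z /negbTE->; rewrite mul0r.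
under eq_bigr do rewrite /segment mulrDl -mulrA mulrBl.
rewrite big_split /= -mulr_sumr sumrB !sum_vp !path_coefE ?(ltnW lti) //.
rewrite /tits_segment /segment -natr1; set a := vertex_point _ _ _.
set b := vertex_point _ _ _; have n0 : n%:R != 0 :> R by rewrite pnatr_eq0 -lt0n.
by field.
Qed.

(** On the edge of [g], the coordinates used for the vertex with index [j] and representative [h]
    are [1 - s] and [s] if [h * g^-1] is in [path_stab j], up to the ambiguity at the ends that
    [hat_00] and [hat_nn] absorb. Otherwise a relevant coordinate is 0 and the hat function
    vanishes. *)
Lemma tits_to_path_segment g i (c s : R) : (i < n)%N -> 0 <= c <= 1 -> 0 <= s <= 1 ->
  n%:R * s = i%:R + c ->
  tits_to_path (tits_segment g s) = segment (to (v i) g) (to (v i.+1) g) c.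
Proof.
move=> lti /andP[c0 c1] /andP[s0 s1] nsc; apply/funext => w; rewrite /tits_to_path.
rewrite /segment /vertex_point /path_index; case: pickP => [[j h] /= /eqP->|none];
  last first.
  have := none (inord i, g); have := none (inord i.+1, g).
  by rewrite /= !inordK ?ltnS ?(ltnW lti) // => -> ->; rewrite subrr mulr0 addr0.
have lej := leq_ord j; rewrite !path_vertex_eq ?(ltnW lti) //.
rewrite !tits_segment_true !tits_segment_false.
have /(_ j) hatE := hat_edge (n := n) (i := i) _ _ nsc.
have inS : (h * g^-1)%g \in path_stab j ->
    hat n j (1 - s) s = (j == i :> nat)%:R + c * ((j == i.+1 :> nat)%:R - (j == i
      :> nat)%:R).
  move=> _; rewrite hatE; last by apply/andP; split; lra.
  by ring.
rewrite /path_stab in inS *.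
have [j0|j0] := eqVneq (j : nat) 0%N.
  have [hJ|hJ] := boolP (_ \in J).
    rewrite !andbT mul1r -inS ?j0 ?hJ //; apply: hat_00 => //; last by lra.
    by case: (_ \in K); rewrite ?mul1r ?mul0r.
  by rewrite !andbF mul0r subrr mulr0 addr0 j0 hat_a0.
have [jn|jn] := eqVneq (j : nat) n.
  have [hK|hK] := boolP (_ \in K).
    rewrite !andbT mul1r -inS ?j0 ?jn ?eqxx ?(gtn_eqF n_gt0) //;
      apply: hat_nn => //; last by lra.
    by case: (_ \in J); rewrite ?mul1r ?mul0r //; lra.
  rewrite !andbF mul0r subrr mulr0 addr0 jn hat_b0 //.
  by case: (_ \in J); rewrite ?mul1r ?mul0r ?ler01 //; lra.
rewrite inE; have [hJ|hJ] := boolP (_ \in J); last first.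
  by rewrite !andbF mul0r subrr mulr0 addr0 hat_a0 // ltn_neqAle jn.
have [hK|hK] := boolP (_ \in K); last first.
  rewrite !andbF mul0r subrr mulr0 addr0 hat_b0 ?lt0n //.
  by rewrite mul1r; lra.
by rewrite !andbT !mul1r inS // (negbTE j0) (negbTE jn) inE hJ hK.
Qed.

Lemma path_to_titsK x : realization R path_complex x ->
  tits_to_path (path_to_tits x) = x.
Proof.
move=> /realization_path[i [g [c [lti c01 ->]]]].
rewrite path_to_tits_segment //; have n0 : 0 < n%:R :> R by rewrite ltr0n.
have /andP[c0 c1] := c01; have lti' : i%:R + 1 <= n%:R :> R by rewrite natr1 ler_nat.
have i0 : 0 <= i%:R :> R by rewrite ler0n.
apply: tits_to_path_segment => //.
  by rewrite divr_ge0 ?ler_pdivrMr ?mul1r //=; lra.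
by rewrite mulrC divfK // gt_eqF.
Qed.

Lemma tits_segment_split g (c : R) : 0 <= c <= 1 -> exists i (d : R),
  [/\ (i < n)%N, 0 <= d <= 1, c = (i%:R + d) / n%:R &
      tits_to_path (tits_segment g c) = segment (to (v i) g) (to (v i.+1) g) d].
Proof.
move=> c01; have n0 : 0 < n%:R :> R by rewrite ltr0n.
have [|i lti iz] := unit_subdivision (z := n%:R * c) n_gt0.
  have /andP[c0 c1] := c01; rewrite mulr_ge0 ?ler0n //=.
  by rewrite -[X in _ <= X]mulr1 ler_wpM2l ?ler0n.
exists i, (n%:R * c - i%:R); have d01 : 0 <= n%:R * c - i%:R <= 1.
  by have /andP[h1 h2] := iz; apply/andP; split; lra.
split=> //; last by apply: tits_to_path_segment => //; ring.
by rewrite addrC subrK mulrC mulKf // gt_eqF.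
Qed.

Lemma tits_to_pathK y : realization R D y -> path_to_tits (tits_to_path y) = y.
Proof.
move=> /realization_tits[g [c [c01 ->]]].
have [i [d [lti d01 cE ->]]] := tits_segment_split g c01.
by rewrite path_to_tits_segment // -cE.
Qed.

Lemma path_to_tits_gmap :
  gmap [set: gT] to path_complex (tits_act gT) D path_to_tits.
Proof.
split.
- apply: ptws_within_continuous => u; apply: within_continuous_sum => w _.
  apply: within_continuousM; last exact: within_cst.
  exact: (within_continuous_coord (f := id) (@within_id _ _)).
- move=> x /realization_path[i [g [c [lti /andP[c0 c1] ->]]]].
  rewrite path_to_tits_segment //; apply: tits_segment_realization.
  have n0 : 0 < n%:R :> R by rewrite ltr0n.
  have lti' : i%:R + 1 <= n%:R :> R by rewrite natr1 ler_nat.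
  have i0 : 0 <= i%:R :> R by rewrite ler0n.
  by rewrite divr_ge0 ?ler_pdivrMr ?mul1r //=; lra.
- move=> x a /realization_path[i [g [c [lti _ ->]]]] _.
  by rewrite ract_segment -!actM !path_to_tits_segment // ract_tits_segment.
Qed.

Lemma tits_to_path_gmap :
  gmap [set: gT] (tits_act gT) D to path_complex tits_to_path.
Proof.
split.
- apply: ptws_within_continuous => w; rewrite /tits_to_path.
  case: (path_index w) => [[j h]|]; last exact: within_cst.
  have cc u : {within realization R D, continuous (fun y => y u)}%classic.
    exact: (within_continuous_coord (f := id) (@within_id _ _)).
  apply: within_continuous_max; first exact: within_cst.
  apply: within_continuous_min; apply: within_continuousD; try exact: within_cst.
    apply: within_continuousB; last exact: within_cst.
    by apply: within_continuousM => //; exact: within_cst.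
  apply: within_continuousB; last exact: within_cst.
  by apply: within_continuousM => //; exact: within_cst.
- move=> y /realization_tits[g [c [c01 ->]]].
  have [i [d [lti d01 _ ->]]] := tits_segment_split g c01.
  exact: path_segment.
- move=> y a /realization_tits[g [c [c01 ->]]] _.
  have [i [d [lti d01 cE tE]]] := tits_segment_split g c01.
  rewrite ract_tits_segment tE ract_segment -!actM.
  apply: tits_to_path_segment => //.
  by rewrite cE mulrC divfK // gt_eqF // ltr0n.
Qed.

End PathComplex.

(** * A shortest path in a minimal non-trivial synthetic building *)

Section Uniqueness.
Variables (R : realType) (gT : finGroupType) (p : nat) (B J K U : {group gT}).
Local Notation parabolic := (parabolic J K).
Local Notation tits_vertex := (tits_vertex J K).
Local Open Scope group_scope.
Hypotheses (JK : lie_rank2 B J K) (F : rank2_parabolics p B J K U).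
Variables (V : finType) (to : {action gT &-> V}) (D : {set {set V}}).

Lemma dvd_prime_Sylow : p %| #|U|.
Proof. by have [] := pgroup_pdiv (pHall_pgroup (parab_Sylow F)) (parab_neq1 F). Qed.

Lemma vertex_synthetic u : u \in 'Fix_to([set: gT]) ->
  synthetic_building R p to [set [set u]]%SET.
Proof.
move=> /afixP fu; have fu' g : to u g = u by apply: fu; rewrite inE.
have fs g : (to^*)%act [set u]%SET g = [set u]%SET.
  by apply/setP => w; rewrite mem_setact_inv !inE (canF_eq (actKV to g)) fu'.
split.
- split.
  + by rewrite inE; apply/eqP => /setP/(_ u); rewrite !inE eqxx.
  + move=> s t; rewrite !inE => /eqP->; rewrite finset.subset1 => /orP[//|/eqP->].
    by rewrite eqxx.
  + by apply/fintype.subsetP => a _; apply/astabsP => s;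
    rewrite !inE -{1}(fs a) (inj_eq (act_inj _ a)).
  + move=> s; rewrite inE => /eqP->; apply/fintype.subsetP => a _.
    by apply/astabP => w; rewrite inE => /eqP->.
- move=> P pP P1; rewrite (_ : fixed_complex _ _ _ = [set [set u]]%SET).
    by apply: gcontractible_vertex => a _.
  apply/setP => s; rewrite [LHS]inE [RHS]inE inE; case: eqP => //= ->.
  by rewrite finset.sub1set; apply/afixP => a _.
- move=> s; rewrite inE => /eqP->; apply: dvdn_trans dvd_prime_Sylow _.
  apply: cardSg; apply/fintype.subsetP => a _.
  by apply/astabsP => w; rewrite !inE -{1}(fu' a) (inj_eq (act_inj _ a)).
Qed.

Hypotheses (minD : minimal_synthetic_building R p to D) (ntD : nontrivial_complex R
  to D).

Let gD : gcomplex to D. Proof. by case: minD => -[]. Qed.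

Let cD (P : {group gT}) : p.-group P -> P :!=: 1 ->
  gcontractible R 'N(P) to (fixed_complex to D P).
Proof. by case: minD => -[_ cD _] _; apply: cD. Qed.

Lemma minimal_sub_eq (D' : {set {set V}}) : D' \subset D ->
  synthetic_building R p to D' -> D' = D.
Proof.
move=> sD'D synD'; case: minD => _ /(_ D') h.
apply/eqP; rewrite finset.eqEproper sD'D /=; apply/negP => /h; exact.
Qed.

Lemma minimal_no_fixed_vertex u : [set u]%SET \in D -> u \notin 'Fix_to([set: gT]).
Proof.
move=> Du; apply/negP => fu.
have uD : [set [set u]]%SET = D.
  by apply: minimal_sub_eq (vertex_synthetic fu); rewrite finset.sub1set.
apply: ntD; rewrite -uD; apply: gcontractible_vertex => a _.
by move/afixP: fu; apply; rewrite inE.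
Qed.

Lemma parabolic_fixed_vertex e :
  exists2 u, [set u]%SET \in D & u \in 'Fix_to(parabolic e).
Proof.
have [Q [pQ Q1 nQ]] : exists Q : {group gT}, [/\ p.-group Q,
  Q :!=: 1 & normal Q (parabolic e)].
  by case: e; [apply: parab_radical F|apply: parab_radical2 F].
have [u [Du _ fu]] := gcontractible_fixed_vertex gD (cD pQ Q1).
by exists u => //; apply: fintype.subsetP fu; apply/afixS/normal_norm.
Qed.

Lemma fixed_sub_stab (C : {set gT}) u : (C \subset 'C[u | to]) = (u \in 'Fix_to(C)).
Proof. by apply/fintype.subsetP/afixP => h a /h; [move/astab1P|move=> ua;
  apply/astab1P]. Qed.

Lemma Borel_stab u : [set u]%SET \in D -> u \in 'Fix_to(B) ->
  'C[u | to] = B \/ exists e, 'C[u | to] = parabolic e.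
Proof.
move=> Du; rewrite -fixed_sub_stab => /(parab_overgroup F (Y :=
  'C[u | to]%G))[] uC; auto.
- by right; exists true.
- by right; exists false.
have := minimal_no_fixed_vertex Du; rewrite -fixed_sub_stab.
by case/negP; apply/fintype.subsetP => g; rewrite uC.
Qed.

Lemma parabolic_stab e u : [set u]%SET \in D -> u \in 'Fix_to(parabolic e) ->
  'C[u | to] = parabolic e.
Proof.
move=> Du fu; have fB : u \in 'Fix_to(B).
  by apply: fintype.subsetP fu; apply/afixS/(parabolic_sup JK).
move: fu; rewrite -fixed_sub_stab => eu.
have not_sub := parabolic_not_sub JK e.
have [uB|[e' ue']] := Borel_stab Du fB.
  by case/negP: not_sub; rewrite (fintype.subset_trans eu) // uB (parabolic_sup JK).
have [<-//|ne] := eqVneq e' e.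
have e'E : e' = ~~ e by move: ne; clear; case: e; case: e'.
by case/negP: not_sub; rewrite -e'E -ue'.
Qed.

(** Repetitions, and inner vertices fixed by [J] or [K], are allowed here; the minimal length
    excludes them. *)
Definition route k (v : nat -> V) : Prop :=
  [/\ v 0%N \in 'Fix_to(J), v k \in 'Fix_to(K),
      forall i, i <= k -> [set v i]%SET \in D /\ v i \in 'Fix_to(B)
    & forall i, i < k -> [set v i; v i.+1]%SET \in D].

Lemma route_exists : exists k v, route k v.
Proof.
have [u Du fu] := parabolic_fixed_vertex true.
have [w Dw fw] := parabolic_fixed_vertex false.
have sUB := sylow_sub_Borel F.
have fB e z : z \in 'Fix_to(parabolic e) -> z \in 'Fix_to(B).
  by apply: fintype.subsetP; apply/afixS/(parabolic_sup JK).
have fU e z : [set z]%SET \in D -> z \in 'Fix_to(parabolic e) ->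
    [set z]%SET \in fixed_complex to D U.
  move=> Dz /fB fz; rewrite inE Dz finset.sub1set.
  by apply: fintype.subsetP fz; exact: afixS.
have cU : gcontractible R B to (fixed_complex to D U).
  by rewrite -(parab_norm F); apply: cD;
    [apply: pHall_pgroup (parab_Sylow F)|apply: parab_neq1 F].
have := gcontractible_fixed_connected gD cU (fU true u Du fu) (fB true u fu) (fU
  false w Dw fw) (fB false w fw).
move=> /connectP[q /(pathP u) qP wE].
have [_ clD _ _] := gD.
have vert a b : [set a; b]%SET \in D -> [set b]%SET \in D.
  move=> abD; apply: clD abD _ _; first by rewrite finset.sub1set !inE eqxx orbT.
  by apply/set0Pn; exists b; rewrite inE.
exists (size q), (fun i => nth u (u :: q) i); split.
- by [].
- by rewrite nth_last /= -wE.
- case=> [_|i /qP /and3P[/vert ? _ ?]] //=; split=> //.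
  exact: fB fu.
- by move=> i /qP /and3P[].
Qed.

Section Shortest.
Variables (n : nat) (v : nat -> V).
Hypotheses (vP : route n v) (minn : forall k v', route k v' -> n <= k).

Let v_vertex i : i <= n -> [set v i]%SET \in D. Proof. by case: vP => _ _ h _ /h[].
Qed.
Let v_Borel i : i <= n -> v i \in 'Fix_to(B). Proof. by case: vP => _ _ h _ /h[]. Qed.

Lemma route_gt0 : 0 < n.
Proof.
rewrite lt0n; apply/eqP => n0; have [v0 vn _ _] := vP; rewrite n0 in vn.
have D0 : [set v 0%N]%SET \in D by apply: v_vertex.
have := parabolic_not_sub JK true.
by rewrite -(parabolic_stab (e := true) D0 v0) -(parabolic_stab (e :=
  false) D0 vn) fintype.subxx.
Qed.

(** An inner vertex fixed by [J] would start a shorter route, and one fixed by [K] would end one. *)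
Lemma route_stab i : i <= n -> 'C[v i | to] = path_stab J K n i.
Proof.
move=> lein; have [v0 vn vv ve] := vP; rewrite /path_stab.
case: eqP => [->|/eqP i0]; first by rewrite (parabolic_stab (e := true)) //;
  apply: v_vertex.
case: eqP => [->|/eqP ni]; first by rewrite (parabolic_stab (e := false)) //;
  apply: v_vertex.
have [->|[e ie]] := Borel_stab (v_vertex lein) (v_Borel lein); first by case: JK.
have fi : v i \in 'Fix_to(parabolic e) by rewrite -fixed_sub_stab ie.
have ltin : i < n by rewrite ltn_neqAle ni.
case: e {ie} fi => fi.
  have /minn : route (n - i) (fun j => v (i + j)%N).
    split; rewrite ?addn0 ?subnKC // => j lej; last by rewrite addnS; apply: ve; lia.
    by apply: vv; lia.
  by rewrite leqNgt ltn_subrL lt0n i0 route_gt0.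
have /minn : route i v.
  by split=> // j lej; [apply: vv|apply: ve]; lia.
by rewrite leqNgt ltin.
Qed.

(** The loop between two equal vertices can be cut out, continuing from [v i] with [v j.+1]. *)
Lemma route_inj i j : i <= n -> j <= n -> v i = v j -> i = j.
Proof.
wlog suff: i j / i < j -> j <= n -> v i = v j -> False.
  move=> h lei lej vij; have [lt|lt|//] := ltngtP i j.
    by case: (h i j).
  by case: (h j i).
move=> ltij lej vij; have [v0 vn vv ve] := vP.
have /minn : route (n - (j - i)) (fun l => if l <= i then v l else v (l + (j - i))%N).
  split=> [//||l lel|l lel].
  - case: leqP => [le|lt]; last by rewrite subnK //; lia.
    have -> : (n - (j - i))%N = i by lia.
    by rewrite vij; have -> : j = n by lia.
  - by case: leqP => h; apply: vv; lia.
  - case: (leqP l i) => h; case: (leqP l.+1 i) => h'.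
    + by apply: ve; lia.
    + have -> : l = i by lia.
      by rewrite vij (_ : (i.+1 + (j - i))%N = j.+1); [apply: ve|]; lia.
    + by lia.
    + by rewrite addSn; apply: ve; lia.
by lia.
Qed.

(** If [k] carries [v i] to [v j], then [B], which fixes [v j], lies in the conjugate by [k] of the
    stabilizer of [v i]. By [tits_fixed_Borel], [k] is in each of [J], [K] that contains this
    stabilizer, hence in the stabilizer; so [v j = v i]. *)
Lemma route_orbit i j g h : i <= n -> j <= n ->
  to (v i) g = to (v j) h -> i = j /\ (g * h^-1)%g \in path_stab J K n i.
Proof.
move=> lei lej vij; set k := g * h^-1.
have vk : to (v i) k = v j by rewrite /k actM vij actK.
have sBk : B \subset path_stab J K n i :^ k.
  rewrite -route_stab // -astab1_act vk fixed_sub_stab; exact: v_Borel.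
have in_parab e : path_stab J K n i \subset parabolic e -> k \in parabolic e.
  move=> se; have : tits_vertex e k \in 'Fix_(tits_act gT)(B).
    by rewrite tits_fixP (fintype.subset_trans sBk) // conjSg.
  by move=> /(tits_fixed_Borel JK F)/eqP; rewrite tits_vertex_eq invg1 mulg1.
have kS : k \in path_stab J K n i.
  have := in_parab true; have := in_parab false; rewrite /path_stab /=.
  case: eqP => _; first by move=> _; apply.
  case: eqP => _; first by move=> + _; apply.
  by rewrite inE => -> => [->|]; rewrite ?finset.subsetIr ?finset.subsetIl.
split=> //; apply: route_inj => //; rewrite -vk.
by apply/esym/astab1P; rewrite route_stab.
Qed.

Lemma route_stab_fix i g : i <= n -> g \in path_stab J K n i -> to (v i) g = v i.
Proof. by move=> lei; rewrite -route_stab // => /astab1P. Qed.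

Local Notation D1 := (path_complex to v n).

Lemma route_complex_sub : D1 \subset D.
Proof.
apply/fintype.subsetP => s /path_complexP[s0 [i [g [lti sE]]]].
have [_ clD _ _] := gD; apply: clD sE s0; rewrite /path_edge -setact2.
by apply: gcomplex_act => //; case: vP => _ _ _; apply.
Qed.

Lemma route_complex_gcomplex : gcomplex to D1.
Proof. exact: (path_complex_gcomplex (J := J) (K := K) route_orbit). Qed.

Lemma route_complex_synthetic : synthetic_building R p to D1.
Proof.
have gD1 := route_complex_gcomplex; split=> //.
  move=> P pP P1.
  have mf := path_to_tits_gmap R route_gt0 route_stab_fix route_orbit.
  have mg := tits_to_path_gmap R route_gt0 route_stab_fix route_orbit.
  apply: (homeo_gcontractible gD1 (tits_gcomplex J K) mf mg).
    exact: (path_to_titsK route_gt0 route_stab_fix route_orbit).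
  exact: (tits_fixed_contractible R JK F).
move=> s /path_complexP[_ [i [g [lti /fintype.subsetP sE]]]].
apply: dvdn_trans dvd_prime_Sylow _; rewrite -(cardJg U g).
suff : U :^ g \subset 'C(s | to).
  by move=> sC; apply/cardSg/(fintype.subset_trans sC)/astab_sub.
apply: fintype.subset_trans (_ : B :^ g \subset _);
  first by rewrite conjSg (sylow_sub_Borel F).
apply/fintype.subsetP => b Bb; apply/astabP => u /sE.
have fix_v l : l <= n -> to (to (v l) g) b = to (v l) g.
  move=> lel; have : b ^ g^-1 \in B by rewrite -mem_conjg.
  move/afixP: (v_Borel lel) => /[apply] vb.
  by rewrite -{2}vb -!actM conjgE invgK !mulgA mulgKV.
by rewrite !inE => /orP[]/eqP->; apply: fix_v => //; apply: ltnW.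
Qed.

Lemma route_ghomotopy_equiv :
  ghomotopy_equiv R [set: gT] to D (tits_act gT) (tits_building J K).
Proof.
rewrite -(minimal_sub_eq route_complex_sub route_complex_synthetic).
have mf := path_to_tits_gmap R route_gt0 route_stab_fix route_orbit.
have mg := tits_to_path_gmap R route_gt0 route_stab_fix route_orbit.
apply: (homeo_ghomotopy_equiv mf mg).
  exact: (path_to_titsK route_gt0 route_stab_fix route_orbit).
exact: (tits_to_pathK route_gt0 route_stab_fix route_orbit).
Qed.

End Shortest.

Lemma minimal_synthetic_unique :
  ghomotopy_equiv R [set: gT] to D (tits_act gT) (tits_building J K).
Proof.
have [k0 [v0 v0P]] := route_exists.
have ex : exists k, `[< exists v, route k v >] by exists k0; apply/asboolP; exists v0.
case: (ex_minnP ex) => n /asboolP[v vP] nmin; apply: (route_ghomotopy_equiv vP).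
by move=> k v' v'P; apply: nmin; apply/asboolP; exists v'.
Qed.

End Uniqueness.

Theorem corollary6p12 (R : realType) (gT : finGroupType) (p : nat)
    (B N J K : {group gT}) :
  prime p -> split_BN_pair p B N -> lie_rank2 B J K ->
  (minimal_synthetic_building R p (tits_act gT) (tits_building J K) /\
   nontrivial_complex R (tits_act gT) (tits_building J K)) /\
  (forall (V : finType) (to : {action gT &-> V}) (D : {set {set V}}),
     minimal_synthetic_building R p to D ->
     nontrivial_complex R to D ->
     ghomotopy_equiv R [set: gT] to D (tits_act gT) (tits_building J K)).
Proof.
move=> pr BN JK; have [U F] := split_BN_pair_parabolics BN JK.
split; first by split; [exact: (tits_minimal R JK F)|exact: (tits_nontrivial JK)].
move=> V to D minD ntD; exact: (minimal_synthetic_unique JK F minD ntD).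
Qed.
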